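(* Let $x>0$ and let $r\ge 2$ be an integer. Then, around $t=1-r$, the (meromorphically continued) function $t\mapsto\Theta(r,r,t,x)$ satisfies \[ \Theta(r,r,t,x) = \frac{\zeta(r)\left(1 + x^{r-1} \right)}{t-(1-r)} + x^{r-1} \zeta(r)(\gamma-\log x) + \gamma \zeta(r) + x^{r-1} \sum_{k=1}^{r-2} \binom{r-1}{k} \frac{1}{x^{k}} \zeta(r-k)\zeta(k+1) + O(|t-(1-r)|) \] as $t\to 1-r$.
   Context: For $x>0$ and $(r,s,t)\in\mathbb{C}^3$ with $\Re(r+t)>1$, $\Re(s+t)>1$, $\Re(r+s+t)>2$, the generalized Mordell–Tornheim zeta function is $\Theta(r,s,t,x)=\sum_{n=1}^{\infty}\sum_{m=1}^{\infty}\frac{1}{n^{r}m^{s}(n+mx)^{t}}$; it extends meromorphically to all of $\mathbb{C}^3$ (in particular, for fixed integer $r\ge2$, $t\mapsto\Theta(r,r,t,x)$ is given by the series for $\Re t>1-r$ and continues meromorphically to a neighbourhood of $t=1-r$). Here $\zeta$ is the Riemann zeta function and $\gamma$ is Euler's constant. *)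

(* Defs.v *)
From Stdlib Require Import Reals.
From Coquelicot Require Import Coquelicot.

Open Scope R_scope.

(* [a ^ s = exp (s log a)] with the principal (real) logarithm; meaningful for
   [0 < a] only. *)
Definition Rcpow (a : R) (s : C) : C :=
  (Rpower a (Re s) * cos (Im s * ln a), Rpower a (Re s) * sin (Im s * ln a)).

(* Complex counterpart of Coquelicot's total [Series]: the sum of the series
   when it converges, an unspecified value otherwise. *)
Definition CSeries (u : nat -> C) : C :=
  (Series (fun n => Re (u n)), Series (fun n => Im (u n))).

(* The Dirichlet series of the Riemann zeta function, valid on the half-plane
   [1 < Re s]; zeta is only evaluated at integers [>= 2] below. *)
Definition zeta (s : C) : C :=
  CSeries (fun n => (/ Rcpow (INR (S n)) s)%C).

Definition euler_gamma : R :=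
  real (Lim_seq (fun n => sum_n_m (fun k => / INR k) 1 n - ln (INR n))).

(* The generalized Mordell-Tornheim double series, meaningful in the region
   of (absolute) convergence [Re (r+t) > 1], [Re (s+t) > 1],
   [Re (r+s+t) > 2]. The summation indices start at 0, hence the successors. *)
Definition Theta_series (r s t : C) (x : R) : C :=
  CSeries (fun n => CSeries (fun m =>
    (/ (Rcpow (INR (S n)) r * Rcpow (INR (S m)) s
        * Rcpow (INR (S n) + INR (S m) * x) t))%C)).

(* [F] has, on a punctured disc around [a], a convergent Laurent expansion
   [F z = sum_(k >= 0) c k (z - a) ^ (k - N)] with finite principal part.
   The value of [F] at [a] itself is irrelevant. *)
Definition meromorphic_at (F : C -> C) (a : C) : Prop :=
  exists (N : nat) (c : nat -> C) (rho : R), 0 < rho /\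
    forall z : C, z <> a -> Cmod (z - a)%C < rho ->
      @is_pseries C_AbsRing C_NormedModule c (z - a)%C ((z - a) ^ N * F z)%C.

(* [F] is the function [t |-> Theta (r, r, t, x)] continued meromorphically
   from [Re t > 1 - r] to a neighbourhood of [1 - r]. *)
Definition is_Theta_continuation (x : R) (r : nat) (F : C -> C) : Prop :=
  (forall t : C, 1 - INR r < Re t ->
     F t = Theta_series (INR r) (INR r) t x) /\
  meromorphic_at F (RtoC (1 - INR r)).

(* Main.v *)
(* Write [t = 1 - r + z] and expand [(n + m x)^(r-1)] by the binomial theorem.
   In the general term of the series only [n^(-r) x^(r-1) m^(-1) (n + m x)^(-z)]
   and [m^(-r) n^(-1) (n + m x)^(-z)] fail to converge normally near [z = 0];
   replacing [n + m x] by [m x] in the first and by [n] in the second makes the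
   difference normally convergent, with value [0] at [z = 0]. Hence Theta is
   [zeta(r) (x^(r-1) sum_m m^(-1) (m x)^(-z) + sum_n n^(-1) n^(-z))] plus a
   power series in [z] whose constant term is the sum of the middle binomial
   terms, and [sum_m m^(-1) (m y)^(-z) = 1/z + (gamma - ln y) + O(z)].
   All power series are controlled by weighted l^1 norms of their coefficients
   in the disc of radius 1/4. A meromorphic continuation is determined by its
   values at real [z > 0], by the identity theorem for power series. *)

Require Import Defs.
From Stdlib Require Import Reals Lra Lia Factorial Binomial.
From Coquelicot Require Import Coquelicot.

Open Scope R_scope.

(** * Complex series *)

(** The weighted norm controls a power series on the whole disc at once, so exchanging sums only
    takes comparisons of nonnegative real series, without any theory of holomorphic functions. Its
    price on [exp (L z)] is [exp (rho |L|)]: at radius 1/4 a factor [(n + m x)^(-z)] costs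
    [(n m)^(1/4)] up to a constant. The tight case is [r = 2]. Replacing [n + m x] by [m x] produces
    the factor [ln (1 + n / (m x))]. Bounding it by [n / (m x)] would leave at least the divergent
    sum of [1 / n], so it is bounded by [2 (n / (m x))^(1/2)]. Then [n^(-2 + 1/2 + 1/4)] and
    [m^(-1 - 1/2 + 1/4)] both have exponent -5/4, and the single series of [n^(-5/4)] serves as
    majorant everywhere. In the lemmas on the double series, [S (S p)] stands for [r]. *)

Notation is_Cseries := (@is_series C_AbsRing C_NormedModule).

Lemma Re_sum_n (u : nat -> C) (n : nat) :
  Re (sum_n u n) = sum_n (fun k => Re (u k)) n.
Proof.
  induction n as [|n IH]; [now rewrite !sum_O|].
  rewrite !sum_Sn, <- IH. reflexivity.
Qed.

Lemma Im_sum_n (u : nat -> C) (n : nat) :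
  Im (sum_n u n) = sum_n (fun k => Im (u k)) n.
Proof.
  induction n as [|n IH]; [now rewrite !sum_O|].
  rewrite !sum_Sn, <- IH. reflexivity.
Qed.

(** [CSeries] is defined componentwise, while limits are taken in the normed module [C]. The balls
    of [C] are boxes, so one [eps] serves both coordinates. *)
Lemma is_Cseries_ReIm (u : nat -> C) (l : C) :
  is_Cseries u l <->
  is_series (fun n => Re (u n)) (Re l) /\ is_series (fun n => Im (u n)) (Im l).
Proof.
  unfold is_series. split.
  - intro H. split; apply filterlim_locally; intro eps;
      generalize (proj1 (filterlim_locally _ _) H eps);
      apply filter_imp; intros n [h1 h2].
    + rewrite <- Re_sum_n. exact h1.
    + rewrite <- Im_sum_n. exact h2.
  - intros [H1 H2]. apply filterlim_locally. intro eps.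
    generalize (filter_and _ _ (proj1 (filterlim_locally _ _) H1 eps)
                  (proj1 (filterlim_locally _ _) H2 eps)).
    apply filter_imp. intros n [h1 h2].
    rewrite <- Re_sum_n in h1. rewrite <- Im_sum_n in h2.
    split; assumption.
Qed.

Lemma is_Cseries_unique (u : nat -> C) (l : C) :
  is_Cseries u l -> CSeries u = l.
Proof.
  intros [H1 H2]%is_Cseries_ReIm. unfold CSeries.
  rewrite (is_series_unique _ _ H1), (is_series_unique _ _ H2).
  now destruct l.
Qed.

Lemma is_Cseries_RtoC (u : nat -> R) (l : R) :
  is_series u l -> is_Cseries (fun n => RtoC (u n)) (RtoC l).
Proof.
  intro H. apply is_Cseries_ReIm. split; [exact H|].
  generalize (is_series_scal_r 0 u l H). rewrite Rmult_0_r.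
  apply is_series_ext. intro n. apply Rmult_0_r.
Qed.

Lemma is_Cseries_ext (u v : nat -> C) (l : C) :
  (forall n, u n = v n) -> is_Cseries u l -> is_Cseries v l.
Proof. intro H. now apply is_series_ext. Qed.

Lemma is_Cseries_plus (u v : nat -> C) (a b : C) :
  is_Cseries u a -> is_Cseries v b ->
  is_Cseries (fun n => u n + v n)%C (a + b)%C.
Proof. apply (is_series_plus (V := C_NormedModule)). Qed.

Lemma is_Cseries_scal (c : C) (u : nat -> C) (a : C) :
  is_Cseries u a -> is_Cseries (fun n => c * u n)%C (c * a)%C.
Proof. apply (is_series_scal (V := C_NormedModule)). Qed.

Lemma is_Cseries_minus (u v : nat -> C) (a b : C) :
  is_Cseries u a -> is_Cseries v b ->
  is_Cseries (fun n => u n - v n)%C (a - b)%C.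
Proof. apply (is_series_minus (V := C_NormedModule)). Qed.

Lemma ex_Cseries_le (u : nat -> C) (b : nat -> R) :
  (forall n, Cmod (u n) <= b n) -> ex_series b ->
  is_Cseries u (CSeries u).
Proof.
  intros H Hb.
  destruct (ex_series_le (V := C_CompleteNormedModule) u b H Hb) as [l Hl].
  now rewrite (is_Cseries_unique u l Hl).
Qed.

Lemma Cmod_sum_n_le (u : nat -> C) (n : nat) :
  Cmod (sum_n u n) <= sum_n (fun k => Cmod (u k)) n.
Proof. apply (norm_sum_n_m (V := C_NormedModule)). Qed.

Lemma is_Cseries_Cmod_le (u : nat -> C) (l : C) (B : R) :
  is_Cseries u l -> (forall n, Cmod (sum_n u n) <= B) -> Cmod l <= B.
Proof.
  intros H HB.
  apply (closed_filterlim_loc (F := eventually) (fun n => Cmod (sum_n u n))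
           (fun y => y <= B)).
  - eapply filterlim_comp; [exact H|].
    apply (filterlim_norm (V := C_NormedModule)).
  - exists O. intros n _. apply HB.
  - apply closed_le.
Qed.

Lemma is_Cseries_lim_zero (u : nat -> C) (l : C) (b : nat -> R) :
  (forall n, Cmod (sum_n u n - l)%C <= b n) -> is_lim_seq b 0 ->
  is_Cseries u l.
Proof.
  intros H Hb. apply is_lim_seq_spec in Hb.
  apply (filterlim_locally_ball_norm (U := C_NormedModule)).
  intro eps. destruct (Hb eps) as [n0 Hn0]. exists n0. intros n Hn.
  unfold ball_norm. apply Rle_lt_trans with (b n); [apply (H n)|].
  specialize (Hn0 n Hn). rewrite Rminus_0_r in Hn0.
  generalize (Rle_abs (b n)). lra.
Qed.

(** * Power series with normally summable coefficients *)

Lemma sum_n_nonneg (a : nat -> R) (n : nat) :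
  (forall k, 0 <= a k) -> 0 <= sum_n a n.
Proof.
  intro H. induction n as [|n IH]; [rewrite sum_O; apply H|].
  rewrite sum_Sn. apply Rplus_le_le_0_compat; [exact IH | apply H].
Qed.

Lemma sum_n_le (a b : nat -> R) (n : nat) :
  (forall k, a k <= b k) -> sum_n a n <= sum_n b n.
Proof. intro H. now apply sum_n_m_le. Qed.

Lemma sum_n_le_Series (a : nat -> R) (n : nat) :
  (forall k, 0 <= a k) -> ex_series a -> sum_n a n <= Series a.
Proof.
  intros H Ha.
  apply (is_lim_seq_incr_compare (sum_n a) (Series a)).
  - exact (Series_correct a Ha).
  - intro k. rewrite sum_Sn. generalize (H (S k)). unfold plus; simpl. lra.
Qed.

Lemma ex_series_bounded (a : nat -> R) (B : R) :
  (forall k, 0 <= a k) -> (forall n, sum_n a n <= B) -> ex_series a.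
Proof.
  intros H HB.
  destruct (ex_finite_lim_seq_incr (sum_n a) B) as [l Hl]; [|exact HB|].
  - intro k. rewrite sum_Sn. generalize (H (S k)). unfold plus; simpl. lra.
  - now exists l.
Qed.

(** The norm is bounded through partial sums, so that [normal] entails convergence instead of
    presupposing it. *)
Definition normal (rho : R) (c : nat -> C) (B : R) : Prop :=
  forall J, sum_n (fun j => Cmod (c j) * rho ^ j) J <= B.

Definition CPS (c : nat -> C) (z : C) : C := CSeries (fun j => c j * z ^ j)%C.

Lemma normal_term_nonneg (rho : R) (c : nat -> C) (j : nat) :
  0 < rho -> 0 <= Cmod (c j) * rho ^ j.
Proof.
  intro H. apply Rmult_le_pos; [apply Cmod_ge_0 | apply pow_le; lra].
Qed.

Lemma normal_term (rho : R) (c : nat -> C) (B : R) (j : nat) :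
  0 < rho -> normal rho c B -> Cmod (c j) * rho ^ j <= B.
Proof.
  intros H0 H. eapply Rle_trans; [|apply (H j)].
  destruct j as [|j]; [rewrite sum_O; lra|].
  rewrite sum_Sn.
  assert (0 <= sum_n (fun j => Cmod (c j) * rho ^ j) j)
    by (apply sum_n_nonneg; intro; now apply normal_term_nonneg).
  unfold plus; simpl in *. lra.
Qed.

Lemma normal_bound_nonneg (rho : R) (c : nat -> C) (B : R) :
  0 < rho -> normal rho c B -> 0 <= B.
Proof.
  intros H0 H. eapply Rle_trans; [|apply (H O)].
  apply sum_n_nonneg; intro; now apply normal_term_nonneg.
Qed.

Lemma normal_le (rho : R) (c : nat -> C) (B B' : R) :
  B <= B' -> normal rho c B -> normal rho c B'.
Proof. intros H Hc J. specialize (Hc J). lra. Qed.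

Lemma normal_ext (rho : R) (c d : nat -> C) (B : R) :
  (forall j, c j = d j) -> normal rho c B -> normal rho d B.
Proof.
  intros H Hc J. eapply Rle_trans; [|apply (Hc J)].
  apply sum_n_le. intro k. rewrite H. apply Rle_refl.
Qed.

Lemma normal_plus (rho : R) (c d : nat -> C) (B B' : R) :
  0 < rho -> normal rho c B -> normal rho d B' ->
  normal rho (fun j => c j + d j)%C (B + B').
Proof.
  intros H0 Hc Hd J.
  apply Rle_trans with
    (sum_n (fun j => plus (Cmod (c j) * rho ^ j) (Cmod (d j) * rho ^ j)) J).
  - apply sum_n_le. intro k. unfold plus; simpl. rewrite <- Rmult_plus_distr_r.
    apply Rmult_le_compat_r; [apply pow_le; lra | apply Cmod_triangle].
  - rewrite sum_n_plus. apply Rplus_le_compat; [apply Hc | apply Hd].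
Qed.

Lemma normal_scal (rho : R) (a : C) (c : nat -> C) (B : R) :
  0 < rho -> normal rho c B -> normal rho (fun j => a * c j)%C (Cmod a * B).
Proof.
  intros H0 Hc J.
  apply Rle_trans with
    (sum_n (fun j => mult (Cmod a) (Cmod (c j) * rho ^ j)) J).
  - apply sum_n_le. intro k. unfold mult; simpl. rewrite Cmod_mult. lra.
  - rewrite sum_n_mult_l.
    apply Rmult_le_compat_l; [apply Cmod_ge_0 | apply Hc].
Qed.

Lemma normal_CPS (rho : R) (c : nat -> C) (B : R) (z : C) :
  0 < rho -> normal rho c B -> Cmod z < rho ->
  is_Cseries (fun j => c j * z ^ j)%C (CPS c z).
Proof.
  intros H0 H Hz.
  apply (ex_Cseries_le _ (fun j => Cmod (c j) * rho ^ j)).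
  - intro j. rewrite Cmod_mult, Cmod_pow.
    apply Rmult_le_compat_l; [apply Cmod_ge_0|].
    apply pow_incr. split; [apply Cmod_ge_0 | lra].
  - apply (ex_series_bounded _ B); [intro; now apply normal_term_nonneg | exact H].
Qed.

Lemma CPS_unique (c : nat -> C) (z l : C) :
  is_Cseries (fun j => c j * z ^ j)%C l -> CPS c z = l.
Proof. apply is_Cseries_unique. Qed.

(** Beyond degree [J] the factor [(Cmod z / rho) ^ j] is at most its value at [S J] and can be
    pulled out; the rest is part of the norm. General [J] gives the exchange of sums; [J = 0] gives
    the error term of the theorem and recovers a constant coefficient. *)
Lemma normal_tail (rho : R) (c : nat -> C) (B : R) (z : C) (J : nat) :
  0 < rho -> normal rho c B -> Cmod z < rho ->
  Cmod (CPS c z - sum_n (fun j => c j * z ^ j)%C J)%C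
    <= B * (Cmod z / rho) ^ S J.
Proof.
  intros H0 H Hz.
  set (a := fun j => (c j * z ^ j)%C).
  set (q := Cmod z / rho).
  set (g := fun j => Cmod (c j) * rho ^ j).
  assert (Hg : forall j, 0 <= g j) by (intro; now apply normal_term_nonneg).
  assert (Hq : 0 <= q <= 1).
  { unfold q. generalize (Cmod_ge_0 z); intro. split.
    - apply Rdiv_le_0_compat; lra.
    - apply Rmult_le_reg_r with rho; [lra|]. field_simplify; lra. }
  assert (Hs : is_Cseries (fun k => a (S J + k)%nat) (CPS c z - sum_n a J)%C).
  { apply (is_series_incr_n (V := C_NormedModule) a (S J)); [lia|].
    replace (plus _ _) with (CPS c z); [now apply normal_CPS with rho B|].
    change (CPS c z = (CPS c z - sum_n a J) + sum_n a J)%C. ring. }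
  apply (is_Cseries_Cmod_le _ _ _ Hs). intro K.
  eapply Rle_trans; [apply Cmod_sum_n_le|].
  apply Rle_trans with (sum_n (fun k => mult (g (S J + k)%nat) (q ^ S J)) K).
  - apply sum_n_le. intro k. unfold a, g, mult; simpl (AbsRing.sort _).
    change (Cmod (c (S J + k)%nat * z ^ (S J + k))%C
            <= Cmod (c (S J + k)%nat) * rho ^ (S J + k) * q ^ S J).
    rewrite Cmod_mult, Cmod_pow, Rmult_assoc.
    apply Rmult_le_compat_l; [apply Cmod_ge_0|].
    replace (Cmod z) with (rho * q) by (unfold q; field; lra).
    rewrite Rpow_mult_distr. apply Rmult_le_compat_l; [apply pow_le; lra|].
    rewrite pow_add. rewrite <- (Rmult_1_r (q ^ S J)) at 2.
    apply Rmult_le_compat_l; [apply pow_le; lra|].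
    rewrite <- (pow1 k). apply pow_incr. lra.
  - rewrite sum_n_mult_r. apply Rmult_le_compat_r; [apply pow_le; lra|].
    eapply Rle_trans; [|apply (H (S J + K)%nat)]. fold g.
    clear -Hg. induction K as [|K IH].
    + rewrite sum_O, Nat.add_0_r, sum_Sn.
      generalize (sum_n_nonneg g J Hg). unfold plus; simpl. lra.
    + rewrite Nat.add_succ_r, !sum_Sn, Nat.add_succ_r.
      apply Rplus_le_compat_r, IH.
Qed.

Lemma normal_CPS_le (rho : R) (c : nat -> C) (B : R) (z : C) :
  0 < rho -> normal rho c B -> Cmod z < rho -> Cmod (CPS c z) <= B.
Proof.
  intros H0 H Hz.
  apply (is_Cseries_Cmod_le _ _ _ (normal_CPS rho c B z H0 H Hz)). intro J.
  eapply Rle_trans; [apply Cmod_sum_n_le|]. eapply Rle_trans; [|apply (H J)].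
  apply sum_n_le. intro j. rewrite Cmod_mult, Cmod_pow.
  apply Rmult_le_compat_l; [apply Cmod_ge_0|].
  apply pow_incr. split; [apply Cmod_ge_0 | lra].
Qed.

Lemma is_Cseries_sum_n (u : nat -> nat -> C) (l : nat -> C) (J : nat) :
  (forall j, is_Cseries (fun n => u n j) (l j)) ->
  is_Cseries (fun n => sum_n (u n) J) (sum_n l J).
Proof.
  intro H. induction J as [|J IH].
  - rewrite sum_O. generalize (H O). apply is_Cseries_ext.
    intro n. now rewrite sum_O.
  - rewrite sum_Sn. generalize (is_Cseries_plus _ _ _ _ IH (H (S J))).
    apply is_Cseries_ext. intro n. now rewrite sum_Sn.
Qed.

Lemma normal_coef_le (rho : R) (c : nat -> C) (B : R) (j : nat) :
  0 < rho -> normal rho c B -> Cmod (c j) <= B / rho ^ j.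
Proof.
  intros H0 H. assert (0 < rho ^ j) by now apply pow_lt.
  apply Rmult_le_reg_r with (rho ^ j); [assumption|].
  field_simplify; [|lra]. rewrite Rmult_comm.
  generalize (normal_term rho c B j H0 H). lra.
Qed.

Lemma normal_series_coef (rho : R) (c : nat -> nat -> C) (B : nat -> R) (j : nat) :
  0 < rho -> (forall n, normal rho (c n) (B n)) -> ex_series B ->
  is_Cseries (fun n => c n j) (CSeries (fun n => c n j)).
Proof.
  intros Hrho Hc HB. apply (ex_Cseries_le _ (fun n => B n * / rho ^ j)).
  - intro n. now apply (normal_coef_le rho (c n) (B n)).
  - now apply ex_series_scal_r.
Qed.

(** A partial sum over [j] is finite, hence moves inside the series in [n], where it is at most
    [B n]. *)
Lemma normal_series (rho : R) (c : nat -> nat -> C) (B : nat -> R) :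
  0 < rho -> (forall n, normal rho (c n) (B n)) -> ex_series B ->
  normal rho (fun j => CSeries (fun n => c n j)) (Series B).
Proof.
  intros Hrho Hc HB J.
  assert (Hj : forall j, ex_series (fun n => Cmod (c n j) * rho ^ j)).
  { intro j. apply (ex_series_le (V := R_CompleteNormedModule) _ B).
    - intro n. change (Rabs (Cmod (c n j) * rho ^ j) <= B n).
      rewrite Rabs_pos_eq by now apply normal_term_nonneg.
      now apply normal_term.
    - exact HB. }
  assert (Hs : is_series (fun n => sum_n (fun j => Cmod (c n j) * rho ^ j) J)
    (sum_n (fun j => Series (fun n => Cmod (c n j) * rho ^ j)) J)).
  { clear -Hj. induction J as [|J IH].
    - rewrite sum_O. generalize (Series_correct _ (Hj O)). apply is_series_ext.
      intro n. now rewrite sum_O.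
    - rewrite sum_Sn.
      generalize (is_series_plus _ _ _ _ IH (Series_correct _ (Hj (S J)))).
      apply is_series_ext. intro n. now rewrite sum_Sn. }
  apply Rle_trans with (sum_n (fun j => Series (fun n => Cmod (c n j) * rho ^ j)) J).
  - apply sum_n_le. intro j.
    assert (0 < rho ^ j) by now apply pow_lt.
    assert (He : ex_series (fun n => Cmod (c n j))).
    { generalize (ex_series_scal_r (/ rho ^ j) _ (Hj j)). apply ex_series_ext.
      intro n. change (Cmod (c n j) * rho ^ j * / rho ^ j = Cmod (c n j)).
      field. lra. }
    rewrite Series_scal_r. apply Rmult_le_compat_r; [lra|].
    apply (is_Cseries_Cmod_le _ _ _ (normal_series_coef rho c B j Hrho Hc HB)). intro N.
    eapply Rle_trans; [apply Cmod_sum_n_le|].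
    apply sum_n_le_Series; [intro; apply Cmod_ge_0 | exact He].
  - rewrite <- (is_series_unique _ _ Hs). apply Series_le; [|exact HB].
    intro n. split; [|apply Hc].
    apply sum_n_nonneg. intro; now apply normal_term_nonneg.
Qed.

(* The tails of all the power series past degree [J] are at most [B n * q ^ J]
   with [q < 1]: this uniformity is what allows the exchange of sums. *)
Lemma normal_series_CPS (rho : R) (c : nat -> nat -> C) (B : nat -> R) (z : C) :
  0 < rho -> (forall n, normal rho (c n) (B n)) -> ex_series B ->
  Cmod z < rho ->
  is_Cseries (fun n => CPS (c n) z) (CPS (fun j => CSeries (fun n => c n j)) z).
Proof.
  intros Hrho Hc HB Hz.
  assert (Hs : is_Cseries (fun n => CPS (c n) z) (CSeries (fun n => CPS (c n) z))).
  { apply (ex_Cseries_le _ B); [|exact HB].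
    intro n. now apply (normal_CPS_le rho). }
  (* By uniqueness of sums, it suffices that the power series with summed coefficients converges to
     the sum of the values. *)
  enough (H : is_Cseries (fun j => CSeries (fun n => c n j) * z ^ j)%C
                (CSeries (fun n => CPS (c n) z)))
    by (now rewrite (CPS_unique _ _ _ H)).
  set (q := Cmod z / rho).
  assert (Hq : 0 <= q < 1).
  { unfold q. generalize (Cmod_ge_0 z); intro. split.
    - apply Rdiv_le_0_compat; lra.
    - apply Rmult_lt_reg_r with rho; [lra|]. field_simplify; lra. }
  apply (is_Cseries_lim_zero _ _ (fun J => Series B * q ^ S J)).
  - intro J.
    (* The series over [n] of the tails past degree [J]. The two uses of [Cmult_comm] only move
       [z ^ j] to the right, in the terms and in the sum. *)
    assert (Hd := is_Cseries_minus _ _ _ _ Hs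
      (is_Cseries_sum_n (fun n j => c n j * z ^ j)%C
         (fun j => CSeries (fun n => c n j) * z ^ j)%C J
         (fun j => is_Cseries_ext _ _ _ (fun n => Cmult_comm (z ^ j) (c n j))
            (eq_ind _ (is_Cseries _)
              (is_Cseries_scal (z ^ j) _ _ (normal_series_coef rho c B j Hrho Hc HB)) _
              (Cmult_comm _ _))))).
    rewrite <- Cmod_opp, Copp_minus_distr.
    apply (is_Cseries_Cmod_le _ _ _ Hd). intro N.
    eapply Rle_trans; [apply Cmod_sum_n_le|].
    apply Rle_trans with (sum_n (fun n => mult (B n) (q ^ S J)) N).
    + apply sum_n_le. intro n. now apply (normal_tail rho).
    + rewrite sum_n_mult_r. apply Rmult_le_compat_r; [apply pow_le; lra|].
      apply sum_n_le_Series; [|exact HB].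
      intro n. exact (normal_bound_nonneg rho (c n) (B n) Hrho (Hc n)).
  - apply (is_lim_seq_incr_1 (fun J => Series B * q ^ J)).
    replace (Finite 0) with (Rbar_mult (Series B) 0)
      by (simpl; now rewrite Rmult_0_r).
    apply is_lim_seq_scal_l, is_lim_seq_geom.
    rewrite Rabs_pos_eq; lra.
Qed.

(** * The exponential series *)

Lemma pow_fact_le_exp (X : R) (n : nat) :
  0 <= X -> sum_n (fun j => X ^ j / INR (fact j)) n <= exp X.
Proof.
  intro HX.
  assert (H : is_series (fun j => X ^ j / INR (fact j)) (exp X)).
  { generalize (is_exp_Reals X). apply is_series_ext. intro j.
    change (pow_n X j * / INR (fact j) = X ^ j / INR (fact j)).
    now rewrite pow_n_pow. }
  rewrite <- (is_series_unique _ _ H). apply sum_n_le_Series.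
  - intro k. apply Rdiv_le_0_compat; [now apply pow_le | apply INR_fact_lt_0].
  - now exists (exp X).
Qed.

Lemma pow_fact_term_le_exp (X : R) (n : nat) :
  0 <= X -> X ^ n / INR (fact n) <= exp X.
Proof.
  intro HX. eapply Rle_trans; [|apply (pow_fact_le_exp X n HX)].
  assert (H : forall k, 0 <= X ^ k / INR (fact k)).
  { intro k. apply Rdiv_le_0_compat; [now apply pow_le | apply INR_fact_lt_0]. }
  destruct n as [|n]; [rewrite sum_O; lra|].
  rewrite sum_Sn. generalize (sum_n_nonneg _ n H). unfold plus;
  unfold plus; simpl. lra.
Qed.

(** At radius [Rabs t + 1] the terms are dominated by those of the series of
    [exp (X * (Rabs t + 1))], hence bounded. *)
Lemma CV_radius_exp_like (a : nat -> R) (X t : R) :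
  0 <= X -> (forall n, Rabs (a n) <= X ^ n / INR (fact n)) ->
  Rbar_lt (Rabs t) (CV_radius a).
Proof.
  intros HX Ha.
  apply Rbar_lt_le_trans with (Finite (Rabs t + 1)); [simpl; lra|].
  apply (CV_radius_bounded a). exists (exp (X * (Rabs t + 1))). intro n.
  generalize (Rabs_pos t); intro.
  rewrite Rabs_mult, (Rabs_pos_eq ((Rabs t + 1) ^ n)) by (apply pow_le; lra).
  eapply Rle_trans; [|apply (pow_fact_term_le_exp _ n)].
  - rewrite Rpow_mult_distr. unfold Rdiv.
    rewrite Rmult_assoc, (Rmult_comm _ (/ _)), <- Rmult_assoc.
    apply Rmult_le_compat_r; [apply pow_le; lra | apply Ha].
  - apply Rmult_le_pos; lra.
Qed.

Lemma Rabs_Re_le (z : C) : Rabs (Re z) <= Cmod z.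
Proof. eapply Rle_trans; [apply Rmax_l | apply Rmax_Cmod]. Qed.

Lemma Rabs_Im_le (z : C) : Rabs (Im z) <= Cmod z.
Proof. eapply Rle_trans; [apply Rmax_r | apply Rmax_Cmod]. Qed.

(* [exp (- t w) * sum_j (t w)^j / j!] has derivative zero in the real variable
   [t]. *)
Lemma is_Cseries_exp (w : C) :
  is_Cseries (fun j => w ^ j * RtoC (/ INR (fact j)))%C
    (exp (Re w) * cos (Im w), exp (Re w) * sin (Im w)).
Proof.
  set (a := Re w). set (b := Im w).
  set (p := fun j => Re (w ^ j)%C / INR (fact j)).
  set (q := fun j => Im (w ^ j)%C / INR (fact j)).
  assert (Hfact : forall n, 0 < INR (fact n)) by (intro; apply INR_fact_lt_0).
  assert (Hp : forall t, Rbar_lt (Rabs t) (CV_radius p)).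
  { intro t. apply (CV_radius_exp_like _ (Cmod w)); [apply Cmod_ge_0|].
    intro n. unfold p, Rdiv.
    rewrite Rabs_mult, <- Cmod_pow, (Rabs_pos_eq (/ _))
      by (left; now apply Rinv_0_lt_compat).
    apply Rmult_le_compat_r; [left; now apply Rinv_0_lt_compat|].
    apply Rabs_Re_le. }
  assert (Hq : forall t, Rbar_lt (Rabs t) (CV_radius q)).
  { intro t. apply (CV_radius_exp_like _ (Cmod w)); [apply Cmod_ge_0|].
    intro n. unfold q, Rdiv.
    rewrite Rabs_mult, <- Cmod_pow, (Rabs_pos_eq (/ _))
      by (left; now apply Rinv_0_lt_compat).
    apply Rmult_le_compat_r; [left; now apply Rinv_0_lt_compat|].
    apply Rabs_Im_le. }
  assert (Ep : forall t, ex_pseries p t) by (intro; now apply CV_radius_inside).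
  assert (Eq : forall t, ex_pseries q t) by (intro; now apply CV_radius_inside).
  set (u := PSeries p). set (v := PSeries q).
  assert (Rew : forall n, Re (w ^ S n)%C = a * Re (w ^ n)%C - b * Im (w ^ n)%C)
    by reflexivity.
  assert (Imw : forall n, Im (w ^ S n)%C = a * Im (w ^ n)%C + b * Re (w ^ n)%C)
    by reflexivity.
  assert (HSn : forall n, INR (S n) <> 0) by (intro; apply not_0_INR; lia).
  (* [Du] and [Dv] together say that [u + i v] has derivative [w (u + i v)]. *)
  assert (Du : forall t, is_derive u t (a * u t - b * v t)).
  { intro t. unfold u, v. rewrite <- !PSeries_scal.
    rewrite <- PSeries_minus by (apply ex_pseries_scal; [apply Rmult_comm|auto]).
    erewrite PSeries_ext; [apply is_derive_PSeries, Hp|].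
    intro n. unfold PS_derive, PS_minus, PS_plus, PS_opp, PS_scal, p, q.
    change (a * (Re (w ^ n)%C / INR (fact n)) + - (b * (Im (w ^ n)%C / INR (fact n)))
      = INR (S n) * (Re (w ^ S n)%C / INR (fact (S n)))).
    rewrite Rew, fact_simpl, mult_INR. field; repeat split; auto using INR_fact_neq_0. }
  assert (Dv : forall t, is_derive v t (a * v t + b * u t)).
  { intro t. unfold u, v. rewrite <- !PSeries_scal.
    rewrite <- PSeries_plus by (apply ex_pseries_scal; [apply Rmult_comm|auto]).
    erewrite PSeries_ext; [apply is_derive_PSeries, Hq|].
    intro n. unfold PS_derive, PS_plus, PS_scal, p, q.
    change (a * (Im (w ^ n)%C / INR (fact n)) + b * (Re (w ^ n)%C / INR (fact n))
      = INR (S n) * (Im (w ^ S n)%C / INR (fact (S n)))).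
    rewrite Imw, fact_simpl, mult_INR. field; repeat split; auto using INR_fact_neq_0. }
  assert (u0 : u 0 = 1).
  { unfold u. rewrite PSeries_0. unfold p. simpl. field. }
  assert (v0 : v 0 = 0).
  { unfold v. rewrite PSeries_0. unfold q. simpl. field. }
  (* [phi] and [psi] are the real and imaginary parts of [exp (- t w) (u t + i v t)]. *)
  set (phi := fun t => exp (- a * t) * (u t * cos (b * t) + v t * sin (b * t))).
  set (psi := fun t => exp (- a * t) * (v t * cos (b * t) - u t * sin (b * t))).
  assert (Hphi : phi 0 = phi 1).
  { apply (eq_is_derive (V := R_NormedModule)); [|lra]. intros t _. unfold phi.
    auto_derive; [split; [eexists; apply Du | split; [eexists; apply Dv | auto]]|].
    replace (Derive (fun x => u x) t) with (a * u t - b * v t)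
      by (symmetry; exact (is_derive_unique _ _ _ (Du t))).
    replace (Derive (fun x => v x) t) with (a * v t + b * u t)
      by (symmetry; exact (is_derive_unique _ _ _ (Dv t))).
    unfold zero; simpl. ring. }
  assert (Hpsi : psi 0 = psi 1).
  { apply (eq_is_derive (V := R_NormedModule)); [|lra]. intros t _. unfold psi.
    auto_derive; [split; [eexists; apply Dv | split; [eexists; apply Du | auto]]|].
    replace (Derive (fun x => u x) t) with (a * u t - b * v t)
      by (symmetry; exact (is_derive_unique _ _ _ (Du t))).
    replace (Derive (fun x => v x) t) with (a * v t + b * u t)
      by (symmetry; exact (is_derive_unique _ _ _ (Dv t))).
    unfold zero; simpl. ring. }
  unfold phi, psi in Hphi, Hpsi.
  rewrite !Rmult_0_r, !Rmult_1_r, u0, v0, exp_0, cos_0, sin_0 in Hphi, Hpsi.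
  rewrite exp_Ropp in Hphi, Hpsi.
  assert (He := exp_pos a).
  assert (H1 : u 1 * cos b + v 1 * sin b = exp a).
  { apply Rmult_eq_reg_l with (/ exp a); [|apply Rinv_neq_0_compat; lra].
    rewrite <- Hphi. field. lra. }
  assert (H2 : v 1 * cos b - u 1 * sin b = 0).
  { apply Rmult_eq_reg_l with (/ exp a); [|apply Rinv_neq_0_compat; lra].
    rewrite <- Hpsi. ring. }
  assert (Hcs := sin2_cos2 b). unfold Rsqr in Hcs.
  (* [H1] and [H2] are a rotation of the unknowns [u 1] and [v 1], inverted with
     [sin^2 + cos^2 = 1]. *)
  assert (Hu : u 1 = exp a * cos b).
  { replace (u 1) with (u 1 * (sin b * sin b + cos b * cos b))
      by (rewrite Hcs; ring).
    replace (u 1 * (sin b * sin b + cos b * cos b))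
      with ((u 1 * cos b + v 1 * sin b) * cos b
             - (v 1 * cos b - u 1 * sin b) * sin b) by ring.
    rewrite H1, H2. ring. }
  assert (Hv : v 1 = exp a * sin b).
  { replace (v 1) with (v 1 * (sin b * sin b + cos b * cos b))
      by (rewrite Hcs; ring).
    replace (v 1 * (sin b * sin b + cos b * cos b))
      with ((u 1 * cos b + v 1 * sin b) * sin b
             + (v 1 * cos b - u 1 * sin b) * cos b) by ring.
    rewrite H1, H2. ring. }
  apply is_Cseries_ReIm. simpl (Re _). simpl (Im _).
  rewrite <- Hu, <- Hv. split.
  - generalize (PSeries_correct _ _ (Ep 1)). apply is_series_ext. intro n.
    change (pow_n 1 n * p n
      = Re (w ^ n)%C * / INR (fact n) - Im (w ^ n)%C * 0).
    rewrite pow_n_pow, pow1. unfold p. field. apply INR_fact_neq_0.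
  - generalize (PSeries_correct _ _ (Eq 1)). apply is_series_ext. intro n.
    change (pow_n 1 n * q n
      = Re (w ^ n)%C * 0 + Im (w ^ n)%C * / INR (fact n)).
    rewrite pow_n_pow, pow1. unfold q. field. apply INR_fact_neq_0.
Qed.

(** Taylor coefficients in [z] of [exp (L z)]; a power [a^(-z)] enters with [L = - ln a]. *)
Definition expc (L : R) (j : nat) : C := RtoC (L ^ j / INR (fact j)).

Lemma is_Cseries_expc (a : R) (z : C) :
  is_Cseries (fun j => expc (- ln a) j * z ^ j)%C (Rcpow a (- z)%C).
Proof.
  replace (Rcpow a (- z)) with
    (exp (Re (RtoC (- ln a) * z)%C) * cos (Im (RtoC (- ln a) * z)%C),
     exp (Re (RtoC (- ln a) * z)%C) * sin (Im (RtoC (- ln a) * z)%C)).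
  - generalize (is_Cseries_exp (RtoC (- ln a) * z)%C). apply is_Cseries_ext.
    intro j. unfold expc, Rdiv. rewrite RtoC_mult, RtoC_pow, Cpow_mult_l. ring.
  - unfold Rcpow, Rpower. destruct z as [s t]. simpl.
    replace (- ln a * s - 0 * t) with (- s * ln a) by ring.
    replace (- ln a * t + 0 * s) with (- t * ln a) by ring. reflexivity.
Qed.

(** * Estimates for exponential coefficients *)

Lemma normal_exp_bound (rho alpha X : R) (c : nat -> C) :
  0 < rho -> 0 <= X -> (forall j, Cmod (c j) <= alpha * (X ^ j / INR (fact j))) ->
  normal rho c (alpha * exp (rho * X)).
Proof.
  intros H0 HX Hc J.
  assert (0 <= alpha).
  { generalize (Hc O) (Cmod_ge_0 (c O)). simpl. lra. }
  apply Rle_trans with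
    (sum_n (fun j => mult alpha ((rho * X) ^ j / INR (fact j))) J).
  - apply sum_n_le. intro j. unfold mult; simpl.
    replace (alpha * ((rho * X) ^ j / INR (fact j)))
      with (alpha * (X ^ j / INR (fact j)) * rho ^ j)
      by (rewrite Rpow_mult_distr; field; apply INR_fact_neq_0).
    apply Rmult_le_compat_r; [apply pow_le; lra | apply Hc].
  - rewrite sum_n_mult_l. apply Rmult_le_compat_l; [assumption|].
    apply pow_fact_le_exp. apply Rmult_le_pos; lra.
Qed.

(** Such a series is [z] times one to which [normal_exp_bound] applies with [beta], and
    multiplication by [z] scales the norm by [rho]. *)
Lemma normal_exp_bound_shift (rho beta X : R) (c : nat -> C) :
  0 < rho -> 0 <= X -> c O = 0 ->
  (forall j, Cmod (c (S j)) <= beta * (X ^ j / INR (fact j))) ->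
  normal rho c (beta * rho * exp (rho * X)).
Proof.
  intros H0 HX c0 Hc.
  assert (Hb : 0 <= beta).
  { generalize (Hc O) (Cmod_ge_0 (c 1%nat)). simpl. lra. }
  assert (HS := normal_exp_bound rho beta X (fun j => c (S j)) H0 HX Hc).
  assert (E : forall J, sum_n (fun j => Cmod (c j) * rho ^ j) (S J)
    = rho * sum_n (fun j => Cmod (c (S j)) * rho ^ j) J).
  { induction J as [|J IH].
    - rewrite sum_Sn, !sum_O, c0, Cmod_0. unfold plus; simpl. ring.
    - rewrite sum_Sn, IH, (sum_Sn _ J). unfold plus; simpl. ring. }
  intros [|J].
  - rewrite sum_O, c0, Cmod_0, Rmult_0_l.
    repeat apply Rmult_le_pos; [lra | lra | left; apply exp_pos].
  - rewrite E. replace (beta * rho * exp (rho * X))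
      with (rho * (beta * exp (rho * X))) by ring.
    apply Rmult_le_compat_l; [lra | apply HS].
Qed.

Lemma pow_diff_le (a b X : R) (j : nat) :
  Rabs a <= X -> Rabs b <= X ->
  Rabs (a ^ S j - b ^ S j) <= INR (S j) * Rabs (a - b) * X ^ j.
Proof.
  intros Ha Hb. assert (HX : 0 <= X) by (generalize (Rabs_pos a); lra).
  induction j as [|j IH].
  - simpl. rewrite !Rmult_1_r, Rmult_1_l. apply Rle_refl.
  - replace (a ^ S (S j) - b ^ S (S j))
      with (a * (a ^ S j - b ^ S j) + (a - b) * b ^ S j) by (simpl; ring).
    eapply Rle_trans; [apply Rabs_triang|]. rewrite !Rabs_mult.
    rewrite (S_INR (S j)), <- RPow_abs.
    replace ((INR (S j) + 1) * Rabs (a - b) * X ^ S j) with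
      (X * (INR (S j) * Rabs (a - b) * X ^ j) + Rabs (a - b) * X ^ S j)
      by (simpl; ring).
    apply Rplus_le_compat.
    + apply Rmult_le_compat; auto using Rabs_pos.
    + apply Rmult_le_compat_l; [apply Rabs_pos|].
      apply pow_incr. split; [apply Rabs_pos | assumption].
Qed.

(** Second-order Taylor remainder of a power at [a]. The constant is twice the sharp one, but it is
    exactly what turns [1 / (j + 2)!] into [1 / j!], hence back into an exponential series. *)
Lemma pow_Taylor2_le (a b X : R) (j : nat) :
  Rabs a <= X -> Rabs b <= X ->
  Rabs (a ^ S (S j) - b ^ S (S j) - INR (S (S j)) * (a - b) * a ^ S j)
    <= INR (S j) * INR (S (S j)) * (a - b) ^ 2 * X ^ j.
Proof.
  intros Ha Hb. assert (HX : 0 <= X) by (generalize (Rabs_pos a); lra).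
  induction j as [|j IH].
  - replace (_ - _ - _) with (- (a - b) ^ 2) by (simpl; ring).
    rewrite Rabs_Ropp, Rabs_pos_eq by apply pow2_ge_0.
    generalize (pow2_ge_0 (a - b)). simpl. lra.
  - replace (a ^ S (S (S j)) - b ^ S (S (S j))
        - INR (S (S (S j))) * (a - b) * a ^ S (S j))
      with (b * (a ^ S (S j) - b ^ S (S j) - INR (S (S j)) * (a - b) * a ^ S j)
        + - (INR (S (S j)) * (a - b) ^ 2 * a ^ S j))
      by (rewrite (S_INR (S (S j))); simpl (_ ^ _); ring).
    eapply Rle_trans; [apply Rabs_triang|].
    rewrite Rabs_Ropp, !Rabs_mult, <- !RPow_abs.
    rewrite (Rabs_pos_eq (INR _)) by apply pos_INR.
    rewrite (pow2_abs (a - b)).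
    set (d := (a - b) ^ 2) in *. assert (Hd : 0 <= d) by apply pow2_ge_0.
    apply Rle_trans with (X * (INR (S j) * INR (S (S j)) * d * X ^ j)
       + INR (S (S j)) * d * X ^ S j).
    + apply Rplus_le_compat.
      * apply Rmult_le_compat; auto using Rabs_pos.
      * apply Rmult_le_compat_l;
          [apply Rmult_le_pos; [apply pos_INR | assumption]|].
        apply pow_incr. split; [apply Rabs_pos | assumption].
    + replace (X * (INR (S j) * INR (S (S j)) * d * X ^ j)
        + INR (S (S j)) * d * X ^ S j)
        with ((INR (S j) + 1) * INR (S (S j)) * (d * X ^ S j))
        by (simpl (X ^ _); ring).
      rewrite (Rmult_assoc _ d). apply Rmult_le_compat_r.
      * apply Rmult_le_pos; [assumption | now apply pow_le].
      * rewrite <- S_INR. apply Rmult_le_compat_l; [apply pos_INR|].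
        apply le_INR. lia.
Qed.

Lemma normal_expc (rho L X : R) :
  0 < rho -> Rabs L <= X -> normal rho (expc L) (exp (rho * X)).
Proof.
  intros H0 HX. rewrite <- (Rmult_1_l (exp _)).
  apply normal_exp_bound; [assumption | generalize (Rabs_pos L); lra |].
  intro j. unfold expc. rewrite Cmod_R, Rmult_1_l. unfold Rdiv.
  rewrite Rabs_mult, <- RPow_abs, (Rabs_pos_eq (/ _))
    by (left; apply Rinv_0_lt_compat, INR_fact_lt_0).
  apply Rmult_le_compat_r; [left; apply Rinv_0_lt_compat, INR_fact_lt_0|].
  apply pow_incr. split; [apply Rabs_pos | assumption].
Qed.

(** The factor [Rabs (a - b)] is the gain from replacing one logarithm by another; it makes the
    remainder of the double series summable. *)
Lemma normal_expc_minus (rho a b X : R) :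
  0 < rho -> Rabs a <= X -> Rabs b <= X ->
  normal rho (fun j => expc a j - expc b j)%C (Rabs (a - b) * rho * exp (rho * X)).
Proof.
  intros H0 Ha Hb.
  apply normal_exp_bound_shift; [assumption | generalize (Rabs_pos a); lra | |].
  - unfold expc. simpl. now rewrite <- RtoC_minus, Rminus_diag.
  - intro j. unfold expc. rewrite <- RtoC_minus, Cmod_R.
    replace (a ^ S j / INR (fact (S j)) - b ^ S j / INR (fact (S j)))
      with ((a ^ S j - b ^ S j) * / INR (fact (S j)))
      by (field; apply INR_fact_neq_0).
    rewrite Rabs_mult, (Rabs_pos_eq (/ _))
      by (left; apply Rinv_0_lt_compat, INR_fact_lt_0).
    apply Rle_trans with
      (INR (S j) * Rabs (a - b) * X ^ j * / INR (fact (S j))).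
    + apply Rmult_le_compat_r; [left; apply Rinv_0_lt_compat, INR_fact_lt_0|].
      now apply pow_diff_le.
    + apply Req_le. rewrite fact_simpl, mult_INR. field.
      split; [apply INR_fact_neq_0 | apply not_0_INR; lia].
Qed.

(** These are the coefficients of [k exp (a z) - (exp (a z) - exp (b z)) / z]. The quotient is
    [(a - b) exp (a z)] up to a series of order [(a - b)^2] without constant term, which is [D]. In
    the application [k = 1 / u] and [a - b = ln (1 + 1 / u)], so both contributions are of order
    [u^(-2)]. *)
Lemma normal_expc_Taylor2 (rho k a b X : R) :
  0 < rho -> Rabs a <= X -> Rabs b <= X ->
  normal rho (fun j => k * expc a j - (expc a (S j) - expc b (S j)))%C
    ((Rabs (k - (a - b)) + (a - b) ^ 2 * rho) * exp (rho * X)).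
Proof.
  intros H0 Ha Hb. assert (HX : 0 <= X) by (generalize (Rabs_pos a); lra).
  set (D := fun j => RtoC (- (a ^ S j - b ^ S j - INR (S j) * (a - b) * a ^ j)
    / INR (fact (S j)))).
  rewrite Rmult_plus_distr_r.
  apply normal_ext with (fun j => RtoC (k - (a - b)) * expc a j + D j)%C.
  - intro j. unfold D, expc. rewrite <- !RtoC_minus, <- !RtoC_mult,
      <- RtoC_minus, <- RtoC_plus. f_equal. rewrite fact_simpl, mult_INR.
    field. split; [apply INR_fact_neq_0 | apply not_0_INR; lia].
  - apply normal_plus; [assumption| |].
    + rewrite <- Cmod_R. apply normal_scal; [assumption|].
      now apply normal_expc.
    + apply normal_exp_bound_shift; [assumption | assumption | |].
      * unfold D. simpl. f_equal. field.
      * intro j. unfold D. rewrite Cmod_R. unfold Rdiv.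
        rewrite Rabs_mult, Rabs_Ropp, (Rabs_pos_eq (/ _))
          by (left; apply Rinv_0_lt_compat, INR_fact_lt_0).
        apply Rle_trans with
          (INR (S j) * INR (S (S j)) * (a - b) ^ 2 * X ^ j * / INR (fact (S (S j)))).
        -- apply Rmult_le_compat_r;
             [left; apply Rinv_0_lt_compat, INR_fact_lt_0|].
           now apply pow_Taylor2_le.
        -- apply Req_le. rewrite !fact_simpl, !mult_INR. field.
           repeat split; [apply INR_fact_neq_0 | apply not_0_INR; lia |
             apply not_0_INR; lia].
Qed.

(** * Logarithm inequalities and the majorant series *)

Lemma exp_monotone (x y : R) : x <= y -> exp x <= exp y.
Proof.
  intros [H| ->]; [left; now apply exp_increasing | apply Rle_refl].
Qed.

Lemma ln_le_sub1 (x : R) : 0 < x -> ln x <= x - 1.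
Proof.
  intro Hx. generalize (exp_ineq1_le (ln x)). rewrite exp_ln by assumption. lra.
Qed.

Lemma ln_succ_bounds (n : nat) :
  / INR (S (S n)) <= ln (INR (S (S n))) - ln (INR (S n)) <= / INR (S n).
Proof.
  assert (H1 : 0 < INR (S n)) by (apply lt_0_INR; lia).
  assert (H2 : 0 < INR (S (S n))) by (apply lt_0_INR; lia).
  assert (E : INR (S (S n)) = INR (S n) + 1) by apply S_INR.
  rewrite <- ln_div by assumption. split.
  - replace (INR (S (S n)) / INR (S n)) with (/ (INR (S n) / INR (S (S n))))
      by (field; lra).
    rewrite ln_Rinv by (apply Rdiv_lt_0_compat; assumption).
    generalize (ln_le_sub1 (INR (S n) / INR (S (S n))) (Rdiv_lt_0_compat _ _ H1 H2)).
    replace (INR (S n) / INR (S (S n)) - 1) with (- / INR (S (S n)))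
      by (rewrite E; field; lra). lra.
  - generalize (ln_le_sub1 (INR (S (S n)) / INR (S n)) (Rdiv_lt_0_compat _ _ H2 H1)).
    replace (INR (S (S n)) / INR (S n) - 1) with (/ INR (S n))
      by (rewrite E; field; lra). lra.
Qed.

(** With [e] the square root of [p / q], [1 + e^2 <= (1 + e)^2] gives
    [ln (1 + p / q) <= 2 ln (1 + e) <= 2 e]. *)
Lemma ln_plus_le (p q : R) : 0 < p -> 0 < q ->
  0 <= ln (p + q) - ln q <= 2 * exp ((ln p - ln q) / 2).
Proof.
  intros Hp Hq. set (e := exp ((ln p - ln q) / 2)).
  assert (He : 0 < e) by apply exp_pos.
  assert (E : p = q * e ^ 2).
  { unfold e. rewrite <- Rsqr_pow2. unfold Rsqr. rewrite <- exp_plus.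
    replace ((ln p - ln q) / 2 + (ln p - ln q) / 2) with (ln p + - ln q) by field.
    rewrite exp_plus, exp_Ropp, !exp_ln by assumption. field. lra. }
  assert (Hr : ln (p + q) - ln q = ln (1 + e ^ 2)).
  { rewrite <- ln_div by lra. f_equal. rewrite E. field. lra. }
  rewrite Hr. split.
  - rewrite <- ln_1. apply ln_le; [lra|]. generalize (pow2_ge_0 e). lra.
  - apply Rle_trans with (ln ((1 + e) * (1 + e))).
    + apply ln_le; [generalize (pow2_ge_0 e); lra|]. nra.
    + rewrite ln_mult by lra. generalize (ln_le_sub1 (1 + e)). lra.
Qed.

(** Integral test in telescoped form: 5 is the first term 1 plus the integral 4 of [t^(-5/4)] from 1
    to infinity, and [4 n^(-1/4)] is that integral from [n] on. *)
Lemma ex_series_npow54 : ex_series (fun n => exp (- (5/4) * ln (INR (S n)))).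
Proof.
  apply (ex_series_bounded _ 5); [intro; left; apply exp_pos|].
  assert (H : forall J, sum_n (fun n => exp (- (5/4) * ln (INR (S n)))) J
    <= 5 - 4 * exp (- (1/4) * ln (INR (S J)))).
  { induction J as [|J IH].
    - rewrite sum_O. simpl. rewrite ln_1, !Rmult_0_r, exp_0. lra.
    - rewrite sum_Sn. unfold plus; simpl (AbelianMonoid.sort _).
      destruct (ln_succ_bounds J) as [Hl _].
      set (l := ln (INR (S (S J)))) in *. set (l' := ln (INR (S J))) in *.
      assert (E : exp (- (1/4) * l') = exp (- (1/4) * l) * exp ((l - l') / 4))
        by (rewrite <- exp_plus; f_equal; field).
      assert (E2 : exp (- (5/4) * l) = exp (- (1/4) * l) * / INR (S (S J))).
      { rewrite <- (exp_ln (INR (S (S J)))) by (apply lt_0_INR; lia). fold l.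
        rewrite <- exp_Ropp, <- exp_plus. f_equal. field. }
      (* [exp u >= 1 + u] with [u = (l - l') / 4 >= 1 / (4 (J + 2))] shows that [4 n^(-1/4)] drops
         by at least the new term. *)
      generalize (exp_ineq1_le ((l - l') / 4)) (exp_pos (- (1/4) * l)).
      rewrite E in IH. simpl in *. nra. }
  intro J. eapply Rle_trans; [apply H|].
  generalize (exp_pos (- (1/4) * ln (INR (S J)))). lra.
Qed.

Lemma ln_INR_S_nonneg (n : nat) : 0 <= ln (INR (S n)).
Proof.
  rewrite <- ln_1. apply ln_le; [lra|]. rewrite S_INR. generalize (pos_INR n). lra.
Qed.

Lemma Rabs_ln_mult_le (n : nat) (x : R) : 0 < x ->
  Rabs (ln (INR (S n) * x)) <= ln (INR (S n)) + Rabs (ln x).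
Proof.
  intro Hx. rewrite ln_mult by (try apply lt_0_INR; try lia; lra).
  eapply Rle_trans; [apply Rabs_triang|].
  rewrite (Rabs_pos_eq (ln (INR _))) by apply ln_INR_S_nonneg. lra.
Qed.

(** * The Laurent expansion of zeta at 1 *)

Lemma Cmod_Rcpow (a : R) (s : C) : Cmod (Rcpow a s) = Rpower a (Re s).
Proof.
  unfold Cmod, Rcpow; simpl (fst _); simpl (snd _).
  replace (_ + _) with (Rpower a (Re s) ^ 2).
  - rewrite <- Rsqr_pow2. apply sqrt_Rsqr. left. apply exp_pos.
  - assert (H := sin2_cos2 (Im s * ln a)). unfold Rsqr in H.
    transitivity (Rpower a (Re s) ^ 2 * (sin (Im s * ln a) * sin (Im s * ln a)
      + cos (Im s * ln a) * cos (Im s * ln a))); [rewrite H|]; ring.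
Qed.

Lemma expc_0 (L : R) : expc L 0 = 1.
Proof. unfold expc. simpl. f_equal. field. Qed.

Lemma expc_1 (L : R) : expc L 1 = L.
Proof. unfold expc. simpl. f_equal. field. Qed.

Lemma is_Cseries_expc_shift (a : R) (z : C) : z <> 0 ->
  is_Cseries (fun j => expc (- ln a) (S j) * z ^ j)%C ((Rcpow a (- z) - 1) / z)%C.
Proof.
  intro Hz.
  assert (H : is_Cseries (fun j => expc (- ln a) (S j) * z ^ S j)%C
    (Rcpow a (- z) - 1)%C).
  { apply (is_series_incr_1 (V := C_NormedModule)
      (fun j => expc (- ln a) j * z ^ j)%C).
    replace (plus _ _) with (Rcpow a (- z)); [apply is_Cseries_expc|].
    change (Rcpow a (- z) = (Rcpow a (- z) - 1) + expc (- ln a) 0 * 1)%C.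
    rewrite expc_0. ring. }
  replace ((Rcpow a (- z) - 1) / z)%C with (/ z * (Rcpow a (- z) - 1))%C
    by (field; assumption).
  generalize (is_Cseries_scal (/ z)%C _ _ H). apply is_Cseries_ext.
  intro j. rewrite Cpow_S. field. assumption.
Qed.

Lemma normal_expc_shift (rho L : R) : 0 < rho ->
  normal rho (fun j => expc L (S j)) (Rabs L * exp (rho * Rabs L)).
Proof.
  intro H0. apply normal_exp_bound; [assumption | apply Rabs_pos |].
  intro j. unfold expc. rewrite Cmod_R. unfold Rdiv.
  rewrite Rabs_mult, <- RPow_abs, (Rabs_pos_eq (/ _))
    by (left; apply Rinv_0_lt_compat, INR_fact_lt_0).
  simpl (Rabs L ^ S j). rewrite Rmult_assoc.
  apply Rmult_le_compat_l; [apply Rabs_pos|].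
  apply Rmult_le_compat_l; [apply pow_le, Rabs_pos|].
  apply Rinv_le_contravar; [apply INR_fact_lt_0|].
  apply le_INR, fact_le. lia.
Qed.

(* Coefficients in [z] of [u^(-1) (u y)^(-z) - ((u y)^(-z) - ((u+1) y)^(-z)) / z]
   with [u = n + 1]: the second term makes the sum over [n] converge normally
   near [z = 0], and telescopes to [y^(-z) / z], which carries the pole. *)
Definition stieltjes_coef (y : R) (n j : nat) : C :=
  (RtoC (/ INR (S n)) * expc (- ln (INR (S n) * y)) j
   - (expc (- ln (INR (S n) * y)) (S j) - expc (- ln (INR (S (S n)) * y)) (S j)))%C.

Lemma CPS_stieltjes_coef (y : R) (n : nat) (z : C) : z <> 0 ->
  CPS (stieltjes_coef y n) z =
    (RtoC (/ INR (S n)) * Rcpow (INR (S n) * y) (- z)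
     - / z * (Rcpow (INR (S n) * y) (- z) - Rcpow (INR (S (S n)) * y) (- z)))%C.
Proof.
  intro Hz. apply CPS_unique.
  set (a := INR (S n) * y). set (b := INR (S (S n)) * y).
  generalize (is_Cseries_minus _ _ _ _
    (is_Cseries_scal (RtoC (/ INR (S n))) _ _ (is_Cseries_expc a z))
    (is_Cseries_minus _ _ _ _ (is_Cseries_expc_shift a z Hz)
      (is_Cseries_expc_shift b z Hz))).
  match goal with |- is_Cseries _ ?l -> is_Cseries _ ?l' =>
    replace l with l' by (field; assumption) end.
  apply is_Cseries_ext. intro j. unfold stieltjes_coef. fold a b. ring.
Qed.

Lemma INR_S_exp (n : nat) : INR (S n) = exp (ln (INR (S n))).
Proof. rewrite exp_ln; [reflexivity | apply lt_0_INR; lia]. Qed.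

(** [normal_expc_Taylor2] yields the order [(n + 1)^(-2)], and the exponential costs
    [(n + 1)^(1/4)]; the exponent -7/4 is weakened to -5/4 to reuse the one majorant. *)
Lemma normal_stieltjes_coef (y : R) (n : nat) : 0 < y ->
  normal (1/4) (stieltjes_coef y n)
    (exp (- (5/4) * ln (INR (S n))) * (2 * exp ((1 + Rabs (ln y)) / 4))).
Proof.
  intro Hy.
  destruct (ln_succ_bounds n) as [Hl1 Hl2].
  assert (HM : 0 < INR (S n)) by (apply lt_0_INR; lia).
  assert (HM' : 1 <= INR (S n)) by (rewrite S_INR; generalize (pos_INR n); lra).
  assert (HS : INR (S (S n)) = INR (S n) + 1) by apply S_INR.
  assert (Hi1 : / INR (S n) <= 1).
  { rewrite <- Rinv_1. apply Rinv_le_contravar; lra. }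
  (* The summand 1 covers [ln (n + 2) - ln (n + 1)], so that one [X] serves both logarithms. *)
  set (X := ln (INR (S n)) + 1 + Rabs (ln y)).
  assert (Ha : Rabs (- ln (INR (S n) * y)) <= X).
  { rewrite Rabs_Ropp. unfold X. generalize (Rabs_ln_mult_le n y Hy). lra. }
  assert (Hb : Rabs (- ln (INR (S (S n)) * y)) <= X).
  { rewrite Rabs_Ropp. unfold X. generalize (Rabs_ln_mult_le (S n) y Hy). lra. }
  eapply normal_le;
    [|apply (normal_expc_Taylor2 (1/4) (/ INR (S n)) _ _ X); try assumption; lra].
  set (d := - ln (INR (S n) * y) - - ln (INR (S (S n)) * y)).
  assert (Ed : d = ln (INR (S (S n))) - ln (INR (S n))).
  { unfold d. rewrite !ln_mult by lra. ring. }
  assert (E2 : / INR (S n) - / INR (S (S n)) <= / INR (S n) ^ 2).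
  { rewrite HS. apply Rmult_le_reg_r with (INR (S n) ^ 2 * (INR (S n) + 1)).
    - apply Rmult_lt_0_compat; [apply pow_lt|]; lra.
    - field_simplify; lra. }
  assert (Hd0 : 0 <= d).
  { rewrite Ed. assert (0 < / INR (S (S n))) by (apply Rinv_0_lt_compat; lra). lra. }
  assert (H1 : Rabs (/ INR (S n) - d) <= / INR (S n) ^ 2).
  { rewrite Rabs_pos_eq; rewrite Ed; lra. }
  assert (H2 : d ^ 2 <= / INR (S n) ^ 2).
  { rewrite <- pow_inv. apply pow_incr. rewrite Ed in *. lra. }
  assert (H3 : / INR (S n) ^ 2 = exp (- 2 * ln (INR (S n)))).
  { rewrite (INR_S_exp n) at 1. simpl. rewrite Rmult_1_r, <- exp_plus, <- exp_Ropp.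
    f_equal. ring. }
  apply Rle_trans with (2 * exp (- 2 * ln (INR (S n))) * exp (1/4 * X)).
  - apply Rmult_le_compat_r; [left; apply exp_pos|]. rewrite <- H3. lra.
  - rewrite (Rmult_comm (exp (- (5/4) * _))), !Rmult_assoc, <- !exp_plus.
    apply Rmult_le_compat_l; [lra|]. apply exp_monotone. unfold X.
    generalize (ln_INR_S_nonneg n). lra.
Qed.

Lemma is_lim_seq_ln_INR_S : is_lim_seq (fun n => ln (INR (S n))) p_infty.
Proof.
  apply (is_lim_comp_seq ln (fun n => INR (S n)) p_infty p_infty).
  - apply is_lim_ln_p.
  - exists O. intros n _. discriminate.
  - apply (is_lim_seq_incr_1 INR), is_lim_seq_INR.
Qed.

Lemma is_lim_seq_Rcpow (y : R) (z : C) : 0 < y -> 0 < Re z ->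
  is_lim_seq (fun n => Cmod (Rcpow (INR (S n) * y) (- z)%C)) 0.
Proof.
  intros Hy Hz.
  apply (is_lim_seq_ext (fun n => exp (- Re z * ln y) * exp (- Re z * ln (INR (S n))))).
  - intro n. rewrite Cmod_Rcpow. unfold Rpower. rewrite <- exp_plus. f_equal.
    rewrite ln_mult by (try apply lt_0_INR; try lia; lra).
    change (Re (- z)%C) with (- Re z). ring.
  - replace (Finite 0) with (Rbar_mult (exp (- Re z * ln y)) 0)
      by (simpl; now rewrite Rmult_0_r).
    apply is_lim_seq_scal_l.
    apply (is_lim_comp_seq exp (fun n => - Re z * ln (INR (S n))) m_infty 0).
    + apply is_lim_exp_m.
    + exists O. intros n _. discriminate.
    + replace m_infty with (Rbar_mult (- Re z) p_infty).
      * apply is_lim_seq_scal_l, is_lim_seq_ln_INR_S.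
      * apply is_Rbar_mult_unique, is_Rbar_mult_sym, is_Rbar_mult_p_infty_neg.
        simpl. lra.
Qed.

Lemma is_Cseries_telescope (f : nat -> C) :
  is_lim_seq (fun n => Cmod (f n)) 0 ->
  is_Cseries (fun n => f n - f (S n))%C (f O).
Proof.
  intro H.
  assert (E : forall n, sum_n (fun n => f n - f (S n))%C n = (f O - f (S n))%C).
  { induction n as [|n IH]; [now rewrite sum_O|].
    rewrite sum_Sn, IH.
    change ((f O - f (S n)) + (f (S n) - f (S (S n))) = f O - f (S (S n)))%C. ring. }
  apply (is_Cseries_lim_zero _ _ (fun n => Cmod (f (S n)))).
  - intro n. rewrite E. apply Req_le. rewrite <- Cmod_opp. f_equal. ring.
  - now apply (is_lim_seq_incr_1 (fun n => Cmod (f n))).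
Qed.

Lemma CPS_plus (rho : R) (c d : nat -> C) (B B' : R) (z : C) :
  0 < rho -> normal rho c B -> normal rho d B' -> Cmod z < rho ->
  CPS (fun j => c j + d j)%C z = (CPS c z + CPS d z)%C.
Proof.
  intros H0 Hc Hd Hz. apply CPS_unique.
  generalize (is_Cseries_plus _ _ _ _ (normal_CPS rho c B z H0 Hc Hz)
    (normal_CPS rho d B' z H0 Hd Hz)).
  apply is_Cseries_ext. intro j. ring.
Qed.

Lemma CPS_scal (rho : R) (a : C) (c : nat -> C) (B : R) (z : C) :
  0 < rho -> normal rho c B -> Cmod z < rho ->
  CPS (fun j => a * c j)%C z = (a * CPS c z)%C.
Proof.
  intros H0 Hc Hz. apply CPS_unique.
  generalize (is_Cseries_scal a _ _ (normal_CPS rho c B z H0 Hc Hz)).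
  apply is_Cseries_ext. intro j. ring.
Qed.

Lemma euler_gamma_series (l : R) :
  is_series (fun n => / INR (S n) - (ln (INR (S (S n))) - ln (INR (S n)))) l ->
  l = euler_gamma.
Proof.
  intro H. unfold euler_gamma. symmetry.
  enough (Hl : is_lim_seq (fun n => sum_n_m (fun k => / INR k) 1 n - ln (INR n)) l)
    by now rewrite (is_lim_seq_unique _ _ Hl).
  apply is_lim_seq_incr_1.
  assert (E : forall n,
    sum_n (fun n => / INR (S n) - (ln (INR (S (S n))) - ln (INR (S n)))) n
    = sum_n_m (fun k => / INR k) 1 (S n) - ln (INR (S (S n)))).
  { induction n as [|n IH].
    - rewrite sum_O, sum_n_n. simpl (INR 1). rewrite ln_1.
      change (/ 1 - (ln (INR 2) - 0) = / 1 - ln (INR 2)). ring.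
    - rewrite sum_Sn, IH, (sum_n_Sm _ _ (S n)) by lia.
      set (s := sum_n_m _ _ _).
      change (s - ln (INR (S (S n)))
        + (/ INR (S (S n)) - (ln (INR (S (S (S n)))) - ln (INR (S (S n)))))
        = s + / INR (S (S n)) - ln (INR (S (S (S n))))).
      ring. }
  (* The partial sums end with [ln (n + 2)], the definition of [euler_gamma] with [ln (n + 1)]; the
     difference added here lies between 0 and [1 / (n + 1)]. *)
  apply (is_lim_seq_ext (fun n =>
    sum_n (fun n => / INR (S n) - (ln (INR (S (S n))) - ln (INR (S n)))) n
    + (ln (INR (S (S n))) - ln (INR (S n))))).
  { intro n. rewrite E. ring. }
  replace (Finite l) with (Rbar_plus l 0) by (simpl; now rewrite Rplus_0_r).
  apply is_lim_seq_plus'; [exact H|].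
  apply (is_lim_seq_le_le (fun _ => 0) _ (fun n => / INR (S n))).
  - intro n. destruct (ln_succ_bounds n) as [h1 h2]. split; [|exact h2].
    assert (0 < / INR (S (S n))) by (apply Rinv_0_lt_compat, lt_0_INR; lia). lra.
  - apply is_lim_seq_const.
  - apply (is_lim_seq_incr_1 (fun n => / INR n)).
    replace (Finite 0) with (Rbar_inv p_infty) by reflexivity.
    apply is_lim_seq_inv; [apply is_lim_seq_INR | discriminate].
Qed.

(** The telescoped part sums to [y^(-z) / z]; [0 < Re z] makes its boundary term vanish. Writing it
    as [1 / z + (y^(-z) - 1) / z] isolates the pole and contributes [- ln y] to the constant, while
    the normally convergent part contributes [euler_gamma]. The cases [y = x] and [y = 1] are
    used. *)
Lemma zeta_at_one_expansion (y : R) : 0 < y ->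
  exists (d : nat -> C) (B : R),
    normal (1/4) d B /\ d O = RtoC (euler_gamma - ln y) /\
    forall z : C, 0 < Re z -> Cmod z < 1/4 ->
      is_Cseries (fun n => RtoC (/ INR (S n)) * Rcpow (INR (S n) * y) (- z))%C
        (/ z + CPS d z)%C.
Proof.
  intro Hy.
  set (B := fun n => exp (- (5/4) * ln (INR (S n)))
    * (2 * exp ((1 + Rabs (ln y)) / 4))).
  assert (HB : ex_series B) by (apply ex_series_scal_r, ex_series_npow54).
  assert (Hn : forall n, normal (1/4) (stieltjes_coef y n) (B n))
    by (intro; now apply normal_stieltjes_coef).
  assert (H4 : 0 < 1/4) by lra.
  assert (Hs := normal_series _ _ _ H4 Hn HB).
  assert (He := normal_expc_shift (1/4) (- ln y) H4).
  eexists (fun j => CSeries (fun n => stieltjes_coef y n j)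
    + expc (- ln y) (S j))%C, _.
  split; [now apply normal_plus; [|exact Hs|exact He]|]. split.
  - rewrite expc_1.
    assert (H := normal_series_coef _ _ _ O H4 Hn HB).
    set (l := CSeries _) in *.
    assert (H' : is_Cseries (fun n => RtoC
      (/ INR (S n) - (ln (INR (S (S n))) - ln (INR (S n))))) l).
    { revert H. apply is_Cseries_ext. intro n. unfold stieltjes_coef.
      rewrite expc_0, !expc_1.
      assert (HM : forall k, 0 < INR (S k)) by (intro; apply lt_0_INR; lia).
      rewrite !ln_mult by auto.
      rewrite <- !RtoC_minus, <- RtoC_mult, <- RtoC_minus. f_equal. ring. }
    destruct (proj1 (is_Cseries_ReIm _ _) H') as [HR _].
    rewrite (euler_gamma_series _ HR) in HR.
    assert (El : l = RtoC euler_gamma).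
    { rewrite <- (is_Cseries_unique _ _ H').
      now apply is_Cseries_unique, is_Cseries_RtoC. }
    rewrite El, <- RtoC_plus. reflexivity.
  - intros z Hz Hz4.
    assert (Hz0 : z <> 0) by (intro E; rewrite E in Hz; simpl in Hz; lra).
    rewrite (CPS_plus _ _ _ _ _ z H4 Hs He Hz4).
    rewrite (CPS_unique _ _ _ (is_Cseries_expc_shift y z Hz0)).
    assert (Ht := is_Cseries_scal (/ z)%C _ _
      (is_Cseries_telescope (fun n => Rcpow (INR (S n) * y) (- z))
        (is_lim_seq_Rcpow y z Hy Hz))).
    generalize (is_Cseries_plus _ _ _ _ Ht
      (normal_series_CPS _ _ _ z H4 Hn HB Hz4)).
    simpl (INR 1). rewrite Rmult_1_l.
    match goal with |- is_Cseries _ ?l -> is_Cseries _ ?l' =>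
      replace l with l' by (field; assumption) end.
    apply is_Cseries_ext. intro n.
    rewrite CPS_stieltjes_coef by assumption. ring.
Qed.

(** * Splitting the double series *)

Lemma Rcpow_plus (a : R) (s t : C) :
  Rcpow a (s + t)%C = (Rcpow a s * Rcpow a t)%C.
Proof.
  unfold Rcpow. change (Re (s + t)%C) with (Re s + Re t).
  change (Im (s + t)%C) with (Im s + Im t).
  rewrite Rpower_plus, Rmult_plus_distr_r, cos_plus, sin_plus.
  unfold Cmult; simpl (fst _); simpl (snd _). f_equal; ring.
Qed.

Lemma Rcpow_INR (a : R) (k : nat) : 0 < a -> Rcpow a (INR k) = RtoC (a ^ k).
Proof.
  intro Ha. unfold Rcpow, RtoC. simpl (Re _). simpl (Im _).
  rewrite Rmult_0_l, cos_0, sin_0, Rpower_pow by assumption. f_equal; ring.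
Qed.

Lemma Rcpow_0 (a : R) : 0 < a -> Rcpow a 0 = 1.
Proof. intro Ha. exact (Rcpow_INR a 0 Ha). Qed.

Lemma Cinv_unique (a b : C) : (a * b = 1 -> / a = b)%C.
Proof.
  intro H. assert (Ha : a <> 0).
  { intro E. rewrite E, Cmult_0_l in H.
    apply (f_equal fst) in H. simpl in H. lra. }
  replace b with (/ a * (a * b))%C by (field; assumption).
  rewrite H. ring.
Qed.

(** Here [S p] plays the role of [r], one successor less than in the lemmas that follow. *)
Lemma inv_Rcpow_near_pole (a : R) (p : nat) (z : C) : 0 < a ->
  (/ Rcpow a (RtoC (1 - INR (S p)) + z) = RtoC (a ^ p) * Rcpow a (- z))%C.
Proof.
  intro Ha. apply Cinv_unique.
  rewrite <- Rcpow_INR by assumption. rewrite <- !Rcpow_plus.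
  rewrite <- (Rcpow_0 a Ha). f_equal.
  rewrite S_INR, RtoC_minus, RtoC_plus. ring.
Qed.

Definition zetaR (k : nat) : R := Series (fun n => / INR (S n) ^ k).

Lemma inv_pow_le_exp (n k : nat) : (2 <= k)%nat ->
  0 <= / INR (S n) ^ k <= exp (- 2 * ln (INR (S n))).
Proof.
  intro Hk. assert (H : 0 < INR (S n)) by (apply lt_0_INR; lia).
  split; [left; now apply Rinv_0_lt_compat, pow_lt|].
  replace (exp _) with (/ INR (S n) ^ 2).
  - apply Rinv_le_contravar; [now apply pow_lt|].
    apply Rle_pow; [rewrite S_INR; generalize (pos_INR n); lra | assumption].
  - rewrite (INR_S_exp n) at 1. simpl.
    rewrite Rmult_1_r, <- exp_plus, <- exp_Ropp. f_equal. ring.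
Qed.

Lemma is_series_zetaR (k : nat) : (2 <= k)%nat ->
  is_series (fun n => / INR (S n) ^ k) (zetaR k).
Proof.
  intro Hk. apply Series_correct.
  apply (ex_series_le (V := R_CompleteNormedModule) _
    (fun n => exp (- (5/4) * ln (INR (S n)))));
    [|exact ex_series_npow54].
  intro n. destruct (inv_pow_le_exp n k Hk) as [h1 h2].
  change (Rabs (/ INR (S n) ^ k) <= exp (- (5/4) * ln (INR (S n)))).
  rewrite Rabs_pos_eq by assumption. eapply Rle_trans; [exact h2|].
  apply exp_monotone. generalize (ln_INR_S_nonneg n). lra.
Qed.

Lemma zeta_INR (k : nat) : (2 <= k)%nat -> zeta (INR k) = RtoC (zetaR k).
Proof.
  intro Hk. apply is_Cseries_unique.
  generalize (is_Cseries_RtoC _ _ (is_series_zetaR k Hk)). apply is_Cseries_ext.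
  intro n. assert (H : 0 < INR (S n)) by (apply lt_0_INR; lia).
  rewrite Rcpow_INR by assumption. apply RtoC_inv, pow_nonzero. lra.
Qed.

(* The terms [1 <= k <= p] of the binomial expansion of
   [(N + M x)^(p+1) / (N^(p+2) M^(p+2))]. *)
Definition cross_term (x : R) (p k : nat) (N M : R) : R :=
  Binomial.C (S p) k * x ^ (S p - k) * (/ N ^ (S (S p) - k) * / M ^ (k + 1)).

Definition cross_weight (x : R) (p : nat) (N M : R) : R :=
  sum_n_m (fun k => cross_term x p k N M) 1 p.

(** The terms [k = 0] and [k = S p] of the binomial formula are split off: they carry the exponent
    -1 of [M] and of [N] respectively. *)
Lemma binomial_weights (x : R) (p : nat) (N M : R) : 0 < x -> 0 < N -> 0 < M ->
  / (N ^ S (S p) * M ^ S (S p)) * (N + M * x) ^ S p =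
  x ^ S p * / N ^ S (S p) * / M + cross_weight x p N M + / N * / M ^ S (S p).
Proof.
  intros Hx HN HM.
  rewrite binomial, <- sum_n_Reals, sum_Sn. unfold sum_n.
  rewrite sum_Sn_m by lia.
  set (f := fun i => Binomial.C (S p) i * N ^ i * (M * x) ^ (S p - i)).
  assert (E : cross_weight x p N M
    = / (N ^ S (S p) * M ^ S (S p)) * sum_n_m f 1 p).
  { unfold cross_weight.
    rewrite <- (sum_n_m_mult_l (K := R_Ring) (/ (N ^ S (S p) * M ^ S (S p)))).
    apply sum_n_m_ext_loc. intros k Hk. unfold mult; simpl (Ring.sort _).
    change (cross_term x p k N M
      = / (N ^ S (S p) * M ^ S (S p)) * f k). unfold f, cross_term.
    replace (N ^ S (S p)) with (N ^ (S (S p) - k) * N ^ k)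
      by (rewrite <- pow_add; f_equal; lia).
    replace (M ^ S (S p)) with (M ^ (k + 1) * M ^ (S p - k))
      by (rewrite <- pow_add; f_equal; lia).
    rewrite Rpow_mult_distr. field.
    repeat split; apply pow_nonzero; lra. }
  rewrite E.
  assert (C0 : Binomial.C (S p) 0 = 1).
  { unfold Binomial.C. rewrite Nat.sub_0_r. simpl (fact 0). simpl (INR 1).
    field. apply INR_fact_neq_0. }
  assert (C1 : Binomial.C (S p) (S p) = 1).
  { unfold Binomial.C. rewrite Nat.sub_diag. simpl (fact 0). simpl (INR 1).
    field. apply INR_fact_neq_0. }
  assert (F0 : f O = (M * x) ^ S p) by (unfold f; rewrite C0, Nat.sub_0_r; ring).
  assert (F1 : f (S p) = N ^ S p) by (unfold f; rewrite C1, Nat.sub_diag; ring).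
  set (S1 := sum_n_m f 1 p).
  change (/ (N ^ S (S p) * M ^ S (S p)) * (f O + S1 + f (S p))
    = x ^ S p * / N ^ S (S p) * / M + / (N ^ S (S p) * M ^ S (S p)) * S1
      + / N * / M ^ S (S p)).
  rewrite F0, F1.
  rewrite Rpow_mult_distr.
  change (N ^ S (S p)) with (N * N ^ S p). change (M ^ S (S p)) with (M * M ^ S p).
  assert (N ^ S p <> 0) by (apply pow_nonzero; lra).
  assert (M ^ S p <> 0) by (apply pow_nonzero; lra).
  set (u := N ^ S p) in *. set (v := M ^ S p) in *. field. repeat split; lra.
Qed.

Lemma is_series_sum_n_m (u : nat -> nat -> R) (l : nat -> R) (p : nat) :
  (forall k, (1 <= k <= p)%nat -> is_series (u k) (l k)) ->
  is_series (fun n => sum_n_m (fun k => u k n) 1 p) (sum_n_m l 1 p).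
Proof.
  induction p as [|p IH]; intro H.
  - rewrite sum_n_m_zero by lia.
    apply (is_series_ext (fun _ => 0)).
    + intro n. now rewrite sum_n_m_zero by lia.
    + apply (filterlim_ext (fun _ => 0)); [|apply filterlim_const].
      intro n. rewrite sum_n_const. symmetry. apply Rmult_0_r.
  - rewrite sum_n_Sm by lia.
    generalize (is_series_plus _ _ _ _ (IH (fun k Hk => H k ltac:(lia)))
      (H (S p) ltac:(lia))).
    apply is_series_ext. intro n. now rewrite sum_n_Sm by lia.
Qed.

Lemma sum_n_m_le_loc (a b : nat -> R) (p : nat) :
  (forall k, (1 <= k <= p)%nat -> a k <= b k) ->
  sum_n_m a 1 p <= sum_n_m b 1 p.
Proof.
  induction p as [|p IH]; intro H.
  - rewrite !sum_n_m_zero by lia. apply Rle_refl.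
  - rewrite !sum_n_Sm by lia. apply Rplus_le_compat.
    + apply IH. intros k Hk. apply H. lia.
    + apply H. lia.
Qed.

Lemma binomial_nonneg (n k : nat) : 0 <= Binomial.C n k.
Proof.
  unfold Binomial.C. apply Rdiv_le_0_compat; [apply pos_INR|].
  apply Rmult_lt_0_compat; apply INR_fact_lt_0.
Qed.

(** For [1 <= k <= p] both exponents [S (S p) - k] and [k + 1] are at least 2. *)
Lemma cross_weight_bound (x : R) (p n m : nat) : 0 < x ->
  Rabs (cross_weight x p (INR (S n)) (INR (S m))) <=
    sum_n_m (fun k => Binomial.C (S p) k * x ^ (S p - k)) 1 p
    * (exp (- 2 * ln (INR (S n))) * exp (- 2 * ln (INR (S m)))).
Proof.
  intro Hx.
  rewrite <- (sum_n_m_mult_r (K := R_Ring)).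
  unfold cross_weight.
  eapply Rle_trans; [apply (norm_sum_n_m (V := R_NormedModule))|].
  apply sum_n_m_le_loc. intros k Hk.
  change (Rabs (cross_term x p k (INR (S n)) (INR (S m)))
    <= Binomial.C (S p) k * x ^ (S p - k)
       * (exp (- 2 * ln (INR (S n))) * exp (- 2 * ln (INR (S m))))).
  destruct (inv_pow_le_exp n (S (S p) - k) ltac:(lia)) as [h1 h2].
  destruct (inv_pow_le_exp m (k + 1) ltac:(lia)) as [h3 h4].
  assert (0 <= Binomial.C (S p) k * x ^ (S p - k))
    by (apply Rmult_le_pos; [apply binomial_nonneg | apply pow_le; lra]).
  unfold cross_term. rewrite Rabs_pos_eq
    by (apply Rmult_le_pos; [|apply Rmult_le_pos]; assumption).
  apply Rmult_le_compat_l; [assumption|].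
  now apply Rmult_le_compat.
Qed.

(* What is left of the general term of the double series after removal of
   [N^(-r) M^(-1) x^(r-1) (M x)^(-z)] and [M^(-r) N^(-1) N^(-z)], the only two
   parts that do not converge normally near [z = 0]. *)
Definition remainder_coef (x : R) (p n m j : nat) : C :=
  let N := INR (S n) in let M := INR (S m) in let L := ln (N + M * x) in
  (RtoC (x ^ S p * / N ^ S (S p) * / M) * (expc (- L) j - expc (- ln (M * x)) j)
   + RtoC (cross_weight x p N M) * expc (- L) j
   + RtoC (/ N * / M ^ S (S p)) * (expc (- L) j - expc (- ln N) j))%C.

Lemma CPS_remainder_coef (x : R) (p n m : nat) (z : C) : 0 < x ->
  let N := INR (S n) in let M := INR (S m) in
  CPS (remainder_coef x p n m) z =
    (RtoC (/ (N ^ S (S p) * M ^ S (S p)) * (N + M * x) ^ S p)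
       * Rcpow (N + M * x) (- z)
     - RtoC (x ^ S p * / N ^ S (S p) * / M) * Rcpow (M * x) (- z)
     - RtoC (/ N * / M ^ S (S p)) * Rcpow N (- z))%C.
Proof.
  intros Hx N M. apply CPS_unique.
  assert (HN : 0 < N) by (apply lt_0_INR; lia).
  assert (HM : 0 < M) by (apply lt_0_INR; lia).
  rewrite binomial_weights by assumption. rewrite !RtoC_plus.
  set (w0 := RtoC (x ^ S p * / N ^ S (S p) * / M)).
  set (w1 := RtoC (cross_weight x p N M)).
  set (w2 := RtoC (/ N * / M ^ S (S p))).
  assert (HL := is_Cseries_expc (N + M * x) z).
  generalize (is_Cseries_plus _ _ _ _ (is_Cseries_plus _ _ _ _
    (is_Cseries_scal w0 _ _ (is_Cseries_minus _ _ _ _ HL (is_Cseries_expc (M * x) z)))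
    (is_Cseries_scal w1 _ _ HL))
    (is_Cseries_scal w2 _ _ (is_Cseries_minus _ _ _ _ HL (is_Cseries_expc N z)))).
  match goal with |- is_Cseries _ ?l -> is_Cseries _ ?l' =>
    replace l with l' by ring end.
  apply is_Cseries_ext. intro j. unfold remainder_coef.
  fold N M w0 w1 w2. ring.
Qed.

(** [k0], [k1], [k2] belong to the three summands of [remainder_coef]. The bound separates into a
    function of [m] and one of [n], so that the inner series and then the outer one can be
    summed. *)
Lemma normal_remainder_coef (x : R) (p : nat) : 0 < x ->
  exists K, forall n m, normal (1/4) (remainder_coef x p n m)
    (exp (- (5/4) * ln (INR (S m))) * (exp (- (5/4) * ln (INR (S n))) * K)).
Proof.
  intro Hx.
  (* Since [N + M x <= N M (1 + x)], every logarithm that occurs is at most [ln N + ln M + K0] in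
     absolute value. *)
  set (K0 := ln (1 + x) + Rabs (ln x)).
  set (E := fun n => exp (- (5/4) * ln (INR (S n)))).
  (* The factors are the weight, [2 x^(-1/2)] from [ln_plus_le], the radius 1/4 from
     [normal_expc_minus], and the part of [exp (X / 4)] independent of [n] and [m]. *)
  set (k0 := x ^ S p * (2 * exp (- (1/2) * ln x)) * (1/4) * exp (1/4 * K0)).
  set (k1 := sum_n_m (fun k => Binomial.C (S p) k * x ^ (S p - k)) 1 p
    * exp (1/4 * K0)).
  set (k2 := (2 * exp (1/2 * ln x)) * (1/4) * exp (1/4 * K0)).
  exists (k0 + k1 + k2). intros n m. fold (E n) (E m).
  set (N := INR (S n)). set (M := INR (S m)).
  set (a := ln N). set (b := ln M).
  assert (HN : 1 <= N) by (unfold N; rewrite S_INR; generalize (pos_INR n); lra).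
  assert (HM : 1 <= M) by (unfold M; rewrite S_INR; generalize (pos_INR m); lra).
  assert (Ha : 0 <= a) by apply ln_INR_S_nonneg.
  assert (Hb : 0 <= b) by apply ln_INR_S_nonneg.
  assert (HMx : 0 < M * x) by (apply Rmult_lt_0_compat; lra).
  set (X := a + b + K0).
  assert (H1x : 0 < ln (1 + x)) by (rewrite <- ln_1; apply ln_increasing; lra).
  assert (Hx0 := Rabs_pos (ln x)).
  assert (HL : Rabs (- ln (N + M * x)) <= X).
  { rewrite Rabs_Ropp, Rabs_pos_eq.
    - apply Rle_trans with (ln (N * M * (1 + x))).
      + apply ln_le; nra.
      + rewrite !ln_mult by nra. unfold X, K0, a, b. lra.
    - rewrite <- ln_1. apply ln_le; nra. }
  assert (HLM : Rabs (- ln (M * x)) <= X).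
  { rewrite Rabs_Ropp. generalize (Rabs_ln_mult_le m x Hx). fold M b.
    unfold X, K0. lra. }
  assert (HLN : Rabs (- ln N) <= X).
  { rewrite Rabs_Ropp, Rabs_pos_eq by assumption. unfold X, K0. fold a. lra. }
  assert (H4 : 0 < 1/4) by lra.
  assert (Elnm : ln (M * x) = b + ln x) by (apply ln_mult; lra).
  assert (EX : exp (1/4 * X) = exp (1/4 * a) * exp (1/4 * b) * exp (1/4 * K0)).
  { rewrite <- !exp_plus. f_equal. unfold X. ring. }
  assert (Hx' : 0 < x ^ S p) by now apply pow_lt.
  destruct (inv_pow_le_exp n (S (S p)) ltac:(lia)) as [hN1 hN2].
  destruct (inv_pow_le_exp m (S (S p)) ltac:(lia)) as [hM1 hM2].
  fold N a in hN1, hN2. fold M b in hM1, hM2.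
  assert (iN : / N = exp (- a)).
  { unfold a. rewrite exp_Ropp, exp_ln by lra. reflexivity. }
  assert (iM : / M = exp (- b)).
  { unfold b. rewrite exp_Ropp, exp_ln by lra. reflexivity. }
  apply normal_le with
    (E m * (E n * k0) + E m * (E n * k1) + E m * (E n * k2)); [lra|].
  unfold remainder_coef. fold N M.
  apply normal_plus; [assumption | apply normal_plus; [assumption| |] |].
  - eapply normal_le; [|apply normal_scal; [assumption|];
      apply (normal_expc_minus (1/4) _ _ X); assumption].
    rewrite Cmod_R, (Rabs_pos_eq (_ * _))
      by (rewrite iM; repeat apply Rmult_le_pos;
          solve [lra | apply pow_le; lra | left; apply exp_pos]).
    destruct (ln_plus_le N (M * x) ltac:(lra) HMx) as [g1 g2].
    rewrite <- Rabs_Ropp.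
    replace (- (- ln (N + M * x) - - ln (M * x)))
      with (ln (N + M * x) - ln (M * x)) by ring.
    rewrite Rabs_pos_eq by assumption.
    (* Only the [ln (M * x)] inside the exponential is expanded; the one on the left has to match
       the goal. *)
    rewrite Elnm in g2 at 2. fold a in g2.
    apply Rle_trans with (x ^ S p * exp (- 2 * a) * / M *
      (2 * exp ((a - (b + ln x)) / 2) * (1/4) * exp (1/4 * X))).
    + apply Rmult_le_compat.
      * rewrite iM. repeat apply Rmult_le_pos;
          solve [lra | apply pow_le; lra | left; apply exp_pos].
      * repeat apply Rmult_le_pos;
          solve [lra | apply pow_le; lra | left; apply exp_pos].
      * rewrite iM. apply Rmult_le_compat_r; [left; apply exp_pos|].
        apply Rmult_le_compat_l; lra.
      * apply Rmult_le_compat_r; [left; apply exp_pos|].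
        apply Rmult_le_compat_r; lra.
    + apply Req_le. rewrite EX, iM. unfold k0, E. fold N M a b.
      replace (exp ((a - (b + ln x)) / 2))
        with (exp (1/2 * a) * exp (- (1/2) * b) * exp (- (1/2) * ln x))
        by (rewrite <- !exp_plus; f_equal; field).
      replace (exp (- (5/4) * a))
        with (exp (- 2 * a) * exp (1/2 * a) * exp (1/4 * a))
        by (rewrite <- !exp_plus; f_equal; field).
      replace (exp (- (5/4) * b))
        with (exp (- b) * exp (- (1/2) * b) * exp (1/4 * b))
        by (rewrite <- !exp_plus; f_equal; field).
      ring.
  - eapply normal_le; [|apply normal_scal; [assumption|];
      apply (normal_expc (1/4) _ X); assumption].
    rewrite Cmod_R.
    eapply Rle_trans; [apply Rmult_le_compat_r;
      [left; apply exp_pos | apply (cross_weight_bound x p n m Hx)]|].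
    fold N M a b. rewrite EX. unfold k1, E. fold N M a b.
    set (s := sum_n_m _ _ _).
    assert (Hs : 0 <= s).
    { unfold s. apply Rle_trans with (sum_n_m (fun _ => 0) 1 p).
      - rewrite sum_n_m_const. rewrite Rmult_0_r. apply Rle_refl.
      - apply sum_n_m_le. intro k.
        apply Rmult_le_pos; [apply binomial_nonneg | apply pow_le; lra]. }
    replace (s * (exp (- 2 * a) * exp (- 2 * b))
        * (exp (1/4 * a) * exp (1/4 * b) * exp (1/4 * K0)))
      with (exp (- (7/4) * b) * (exp (- (7/4) * a) * (s * exp (1/4 * K0)))).
    2:{ replace (- (7/4) * a) with (- 2 * a + 1/4 * a) by field.
        replace (- (7/4) * b) with (- 2 * b + 1/4 * b) by field.
        rewrite !exp_plus. ring. }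
    assert (Hsk : 0 <= s * exp (1/4 * K0))
      by (apply Rmult_le_pos; [assumption | left; apply exp_pos]).
    apply Rmult_le_compat; [left; apply exp_pos | | apply exp_monotone; lra|].
    + apply Rmult_le_pos; [left; apply exp_pos | assumption].
    + apply Rmult_le_compat_r; [assumption | apply exp_monotone; lra].
  - eapply normal_le; [|apply normal_scal; [assumption|];
      apply (normal_expc_minus (1/4) _ _ X); assumption].
    rewrite Cmod_R, (Rabs_pos_eq (_ * _))
      by (rewrite iN; repeat apply Rmult_le_pos;
          solve [lra | apply pow_le; lra | left; apply exp_pos]).
    destruct (ln_plus_le (M * x) N HMx ltac:(lra)) as [g1 g2].
    rewrite (Rplus_comm (M * x)) in g1, g2.
    rewrite <- Rabs_Ropp.
    replace (- (- ln (N + M * x) - - ln N))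
      with (ln (N + M * x) - ln N) by ring.
    rewrite Rabs_pos_eq by assumption.
    rewrite Elnm in g2. fold a in g2.
    apply Rle_trans with (/ N * exp (- 2 * b) *
      (2 * exp ((b + ln x - a) / 2) * (1/4) * exp (1/4 * X))).
    + apply Rmult_le_compat.
      * rewrite iN. repeat apply Rmult_le_pos;
          solve [lra | apply pow_le; lra | left; apply exp_pos].
      * repeat apply Rmult_le_pos;
          solve [lra | apply pow_le; lra | left; apply exp_pos].
      * rewrite iN. apply Rmult_le_compat_l; [left; apply exp_pos | lra].
      * apply Rmult_le_compat_r; [left; apply exp_pos|].
        apply Rmult_le_compat_r; [lra | fold a; lra].
    + apply Req_le. rewrite EX, iN. unfold k2, E. fold N M a b.
      replace (exp ((b + ln x - a) / 2))
        with (exp (1/2 * b) * exp (- (1/2) * a) * exp (1/2 * ln x))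
        by (rewrite <- !exp_plus; f_equal; field).
      replace (exp (- (5/4) * b))
        with (exp (- 2 * b) * exp (1/2 * b) * exp (1/4 * b))
        by (rewrite <- !exp_plus; f_equal; field).
      replace (exp (- (5/4) * a))
        with (exp (- a) * exp (- (1/2) * a) * exp (1/4 * a))
        by (rewrite <- !exp_plus; f_equal; field).
      ring.
Qed.

(** * Expansion and uniqueness of the continuation *)

Definition cross_constant (x : R) (p : nat) : R :=
  sum_n_m (fun k => Binomial.C (S p) k * x ^ (S p - k)
    * (zetaR (S (S p) - k) * zetaR (k + 1))) 1 p.

(** [D n] is the expansion of row [n]; it is exposed because [Theta_series] is an iterated sum. *)
Lemma remainder_expansion (x : R) (p : nat) : 0 < x ->
  exists (D : nat -> nat -> C) (d : nat -> C) (B : R),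
    normal (1/4) d B /\ d O = RtoC (cross_constant x p) /\
    forall z, Cmod z < 1/4 ->
      (forall n, is_Cseries (fun m => CPS (remainder_coef x p n m) z) (CPS (D n) z))
      /\ is_Cseries (fun n => CPS (D n) z) (CPS d z).
Proof.
  intro Hx. destruct (normal_remainder_coef x p Hx) as [K HK].
  set (E := fun n => exp (- (5/4) * ln (INR (S n)))) in *.
  assert (H4 : 0 < 1/4) by lra.
  set (D := fun n j => CSeries (fun m => remainder_coef x p n m j)).
  assert (HE : forall n, ex_series (fun m => E m * (E n * K)))
    by (intro; apply ex_series_scal_r, ex_series_npow54).
  assert (HD : forall n, normal (1/4) (D n) (E n * (K * Series E))).
  { intro n. replace (E n * (K * Series E)) with (Series (fun m => E m * (E n * K)))
      by (rewrite Series_scal_r; ring).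
    now apply normal_series. }
  assert (HE' : ex_series (fun n => E n * (K * Series E)))
    by (apply ex_series_scal_r, ex_series_npow54).
  exists D, (fun j => CSeries (fun n => D n j)), (Series (fun n => E n * (K * Series E))).
  split; [now apply normal_series|]. split.
  - apply is_Cseries_unique.
    assert (H1 : forall n, D n O = RtoC (sum_n_m (fun k =>
      Binomial.C (S p) k * x ^ (S p - k)
        * (/ INR (S n) ^ (S (S p) - k) * zetaR (k + 1))) 1 p)).
    { intro n. apply is_Cseries_unique.
      apply is_Cseries_ext with
        (fun m => RtoC (cross_weight x p (INR (S n)) (INR (S m)))).
      (* At degree 0 every [expc] equals 1, so both differences cancel and only [cross_weight]
         remains; its terms are products in [n] and [m], hence sum to products of two zeta
         values. *)
      - intro m. unfold remainder_coef. rewrite !expc_0. ring.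
      - apply is_Cseries_RtoC. unfold cross_weight.
        apply (is_series_sum_n_m (fun k m => cross_term x p k (INR (S n)) (INR (S m)))).
        intros k Hk. unfold cross_term.
        apply (is_series_scal (V := R_NormedModule)).
        apply (is_series_scal (V := R_NormedModule)).
        apply is_series_zetaR. lia. }
    apply is_Cseries_ext with (fun n => RtoC (sum_n_m (fun k =>
      Binomial.C (S p) k * x ^ (S p - k)
        * (/ INR (S n) ^ (S (S p) - k) * zetaR (k + 1))) 1 p)); [now intro|].
    apply is_Cseries_RtoC. unfold cross_constant.
    apply (is_series_sum_n_m (fun k n => Binomial.C (S p) k * x ^ (S p - k)
        * (/ INR (S n) ^ (S (S p) - k) * zetaR (k + 1)))).
    intros k Hk.
    apply (is_series_scal (V := R_NormedModule)).
    apply is_series_scal_r, is_series_zetaR. lia.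
  - intros z Hz. split.
    + intro n. now apply (normal_series_CPS (1/4) _ (fun m => E m * (E n * K))).
    + now apply (normal_series_CPS (1/4) _ (fun n => E n * (K * Series E))).
Qed.

Lemma Theta_expansion (x : R) (p : nat) : 0 < x ->
  exists (d : nat -> C) (B : R),
    normal (1/4) d B /\
    d O = RtoC (x ^ S p * zetaR (S (S p)) * (euler_gamma - ln x)
      + euler_gamma * zetaR (S (S p)) + cross_constant x p) /\
    forall z, 0 < Re z -> Cmod z < 1/4 ->
      Theta_series (INR (S (S p))) (INR (S (S p))) (RtoC (1 - INR (S (S p))) + z) x
      = (RtoC (zetaR (S (S p)) * (1 + x ^ S p)) / z + CPS d z)%C.
Proof.
  intro Hx. set (r := S (S p)). set (Z := zetaR r).
  assert (H4 : 0 < 1/4) by lra.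
  destruct (remainder_expansion x p Hx) as (D & dG & BG & HG & G0 & HGz).
  destruct (zeta_at_one_expansion x Hx) as (dx & Bx & Hnx & x0 & Hxz).
  destruct (zeta_at_one_expansion 1 Rlt_0_1) as (d1 & B1 & Hn1 & d10 & H1z).
  assert (Hsx := normal_scal _ (RtoC (x ^ S p * Z)) _ _ H4 Hnx).
  assert (Hs1 := normal_scal _ (RtoC Z) _ _ H4 Hn1).
  assert (Hs := normal_plus _ _ _ _ _ H4 Hsx Hs1).
  eexists (fun j => RtoC (x ^ S p * Z) * dx j + RtoC Z * d1 j + dG j)%C, _.
  split; [exact (normal_plus _ _ _ _ _ H4 Hs HG)|]. split.
  - rewrite G0, x0, d10, ln_1, <- !RtoC_mult, <- !RtoC_plus. f_equal. ring.
  - intros z Hz Hz4.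
    assert (Hz0 : z <> 0) by (intro E; rewrite E in Hz; simpl in Hz; lra).
    rewrite (CPS_plus _ _ _ _ _ z H4 Hs HG Hz4),
      (CPS_plus _ _ _ _ _ z H4 Hsx Hs1 Hz4),
      (CPS_scal _ _ _ _ z H4 Hnx Hz4), (CPS_scal _ _ _ _ z H4 Hn1 Hz4).
    destruct (HGz z Hz4) as [HGn HGs].
    specialize (Hxz z Hz Hz4). specialize (H1z z Hz Hz4).
    assert (Hr := is_series_zetaR r ltac:(unfold r; lia)).
    (* Row [n] consists of the remainder, the part with [M x], summed by the expansion with [y = x],
       and the part with [N], whose sum over [m] brings [zetaR r]. *)
    assert (Hin : forall n, is_Cseries (fun m =>
      (/ (Rcpow (INR (S n)) (INR r) * Rcpow (INR (S m)) (INR r)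
        * Rcpow (INR (S n) + INR (S m) * x) (RtoC (1 - INR r) + z)))%C)
      (CPS (D n) z + RtoC (x ^ S p * / INR (S n) ^ r) * (/ z + CPS dx z)
        + (RtoC (/ INR (S n)) * Rcpow (INR (S n)) (- z)) * RtoC Z)%C).
    { intro n.
      generalize (is_Cseries_plus _ _ _ _ (is_Cseries_plus _ _ _ _ (HGn n)
        (is_Cseries_scal (RtoC (x ^ S p * / INR (S n) ^ r)) _ _ Hxz))
        (is_Cseries_scal (RtoC (/ INR (S n)) * Rcpow (INR (S n)) (- z))%C _ _
          (is_Cseries_RtoC _ _ Hr))).
      apply is_Cseries_ext. intro m.
      rewrite (CPS_remainder_coef x p n m z Hx). fold r.
      set (N := INR (S n)). set (M := INR (S m)).
      assert (HN : 0 < N) by (apply lt_0_INR; lia).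
      assert (HM : 0 < M) by (apply lt_0_INR; lia).
      assert (HL : 0 < N + M * x) by nra.
      rewrite !Rcpow_INR by assumption.
      replace (/ (RtoC (N ^ r) * RtoC (M ^ r) * Rcpow (N + M * x) (RtoC (1 - INR r) + z)))%C
        with (RtoC (/ (N ^ r * M ^ r)) * / Rcpow (N + M * x) (RtoC (1 - INR r) + z))%C.
      2:{ rewrite RtoC_inv, RtoC_mult
            by (apply Rmult_integral_contrapositive_currified; apply pow_nonzero; lra).
          assert (A1 : RtoC (N ^ r) <> 0)
            by (intro E; apply RtoC_inj in E; revert E; apply pow_nonzero; lra).
          assert (A2 : RtoC (M ^ r) <> 0)
            by (intro E; apply RtoC_inj in E; revert E; apply pow_nonzero; lra).
          assert (A3 : Rcpow (N + M * x) (RtoC (1 - INR r) + z) <> 0).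
          { intro E. apply (f_equal Cmod) in E. rewrite Cmod_Rcpow, Cmod_0 in E.
            revert E. apply Rgt_not_eq, exp_pos. }
          field. auto. }
      unfold r. rewrite inv_Rcpow_near_pole by assumption.
      rewrite !RtoC_mult. ring. }
    apply is_Cseries_unique.
    apply is_Cseries_ext with (fun n =>
      CPS (D n) z + RtoC (x ^ S p * / INR (S n) ^ r) * (/ z + CPS dx z)
        + (RtoC (/ INR (S n)) * Rcpow (INR (S n)) (- z)) * RtoC Z)%C.
    { intro n. symmetry. apply is_Cseries_unique, Hin. }
    (* In the outer sum the roles are exchanged: the second part brings [zetaR r] and the third uses
       the expansion with [y = 1]. *)
    generalize (is_Cseries_plus _ _ _ _ (is_Cseries_plus _ _ _ _ HGs
      (is_Cseries_scal (RtoC (x ^ S p) * (/ z + CPS dx z))%C _ _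
        (is_Cseries_RtoC _ _ Hr)))
      (is_Cseries_scal (RtoC Z) _ _ H1z)).
    match goal with |- is_Cseries _ ?l -> is_Cseries _ ?l' =>
      replace l with l' by (fold Z; rewrite !RtoC_mult, RtoC_plus; field; assumption) end.
    apply is_Cseries_ext. intro n. rewrite Rmult_1_r, !RtoC_mult. ring.
Qed.

(** * Identity theorem for power series and Laurent expansions *)

Lemma is_pseries_Cseries (c : nat -> C) (z l : C) :
  @is_pseries C_AbsRing C_NormedModule c z l <->
  is_Cseries (fun j => c j * z ^ j)%C l.
Proof.
  assert (E : forall j, @scal C_AbsRing C_NormedModule (pow_n z j) (c j)
    = (c j * z ^ j)%C).
  { intro j. apply (Cmult_comm (z ^ j)). }
  split; apply is_series_ext; intro; now rewrite E.
Qed.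

(** Each term is a partial sum or a difference of two, hence at most [2 * M]; at half the radius the
    terms are dominated by [2 M (1/2)^j]. *)
Lemma normal_of_convergent (c : nat -> C) (z l : C) (rho : R) :
  0 < rho -> Cmod z = 2 * rho -> is_Cseries (fun j => c j * z ^ j)%C l ->
  exists B, normal rho c B.
Proof.
  intros H0 Hz H.
  destruct (filterlim_bounded (V := C_NormedModule)
    (sum_n (fun j => c j * z ^ j)%C)) as [M HM]; [now exists l|].
  change (forall n, Cmod (sum_n (fun j => c j * z ^ j)%C n) <= M) in HM.
  assert (Ht : forall j, Cmod (c j * z ^ j)%C <= 2 * M).
  { intros [|j].
    - generalize (HM O) (Cmod_ge_0 (c O * z ^ 0)%C). rewrite sum_O. lra.
    - replace (c (S j) * z ^ S j)%C with
        (sum_n (fun j => c j * z ^ j)%C (S j) - sum_n (fun j => c j * z ^ j)%C j)%C.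
      + eapply Rle_trans; [apply Cmod_triangle|]. rewrite Cmod_opp.
        generalize (HM j) (HM (S j)). lra.
      + rewrite sum_Sn. set (s := sum_n _ _).
        change (s + c (S j) * z ^ S j - s = c (S j) * z ^ S j)%C. ring. }
  exists (2 * M * 2). intro J.
  apply Rle_trans with (sum_n (fun j => mult (2 * M) ((1/2) ^ j)) J).
  - apply sum_n_le. intro j. specialize (Ht j).
    rewrite Cmod_mult, Cmod_pow, Hz in Ht.
    unfold mult; simpl. apply Rmult_le_reg_r with (2 ^ j); [apply pow_lt; lra|].
    rewrite Rmult_assoc, (Rmult_assoc (2 * M)), <- !Rpow_mult_distr.
    replace (1/2 * 2) with 1 by field. rewrite pow1, (Rmult_comm rho). lra.
  - rewrite sum_n_mult_l.
    assert (0 <= M) by (generalize (HM O) (Cmod_ge_0 (sum_n (fun j => c j * z ^ j)%C 0)); lra).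
    apply Rmult_le_compat_l; [lra|].
    enough (E : sum_n (fun j => (1/2) ^ j) J = 2 - (1/2) ^ J)
      by (eapply Rle_trans; [apply Req_le, E | generalize (pow_le (1/2) J); lra]).
    clear. induction J as [|J IH]; [rewrite sum_O; simpl; lra|].
    rewrite sum_Sn, IH. unfold plus; simpl. lra.
Qed.

(** Letting [t] tend to 0 gives the constant coefficient; dividing by [t] then shifts the others
    down. Positive real [t] suffice, and these lie on the side where the double series prescribes
    the continuation. *)
Lemma power_series_vanishing (c : nat -> C) (delta : R) : 0 < delta ->
  (forall t : R, 0 < t < delta -> is_Cseries (fun j => c j * RtoC t ^ j)%C (RtoC 0)) ->
  forall j, c j = 0.
Proof.
  intro Hd.
  assert (Z : forall c : nat -> C, (forall t : R, 0 < t < delta ->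
    is_Cseries (fun j => c j * RtoC t ^ j)%C (RtoC 0)) -> c O = 0).
  { clear c. intros c H.
    destruct (normal_of_convergent c (RtoC (delta / 2)) 0 (delta / 4)) as [B HB].
    - lra.
    - rewrite Cmod_R, Rabs_pos_eq by lra. field.
    - apply H. lra.
    - assert (HB0 := normal_bound_nonneg (delta / 4) c B ltac:(lra) HB).
      apply Cmod_eq_0. apply Rle_antisym; [|apply Cmod_ge_0].
      apply le_epsilon. intros e He. rewrite Rplus_0_l.
      (* [delta / 8] keeps [t] inside the disc of radius [delta / 4]; the other bound makes the tail
         [B * (t / (delta / 4))] at most [e], with [B + 1] in place of [B] to avoid dividing by
         zero. *)
      set (t := Rmin (delta / 8) (e * (delta / 4) / (B + 1))).
      assert (Ht0 : 0 < t).
      { apply Rmin_glb_lt; [lra|]. apply Rdiv_lt_0_compat; nra. }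
      assert (Ht1 : t <= delta / 8) by apply Rmin_l.
      assert (Ht2 : t <= e * (delta / 4) / (B + 1)) by apply Rmin_r.
      assert (Hz : Cmod (RtoC t) = t) by (rewrite Cmod_R; apply Rabs_pos_eq; lra).
      assert (HT := normal_tail (delta / 4) c B (RtoC t) O ltac:(lra) HB
        ltac:(rewrite Hz; lra)).
      rewrite (CPS_unique _ _ _ (H t ltac:(lra))), sum_O, Hz in HT.
      replace (Cmod (c O)) with (Cmod (0 - c O * RtoC t ^ 0)%C)
        by (rewrite <- Cmod_opp; f_equal; simpl; ring).
      eapply Rle_trans; [exact HT|]. rewrite pow_1.
      apply Rle_trans with ((B + 1) * (t / (delta / 4))).
      + apply Rmult_le_compat_r; [|lra]. apply Rdiv_le_0_compat; lra.
      + apply Rmult_le_reg_r with ((delta / 4) / (B + 1)).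
        * apply Rdiv_lt_0_compat; lra.
        * replace ((B + 1) * (t / (delta / 4)) * (delta / 4 / (B + 1)))
            with t by (field; lra).
          unfold Rdiv in *. lra. }
  intros H j. revert c H. induction j as [|j IH]; intros c H; [now apply Z|].
  apply (IH (fun j => c (S j))). intros t Ht.
  assert (Ht0 : RtoC t <> 0) by (intro E; apply RtoC_inj in E; lra).
  assert (H' : is_Cseries (fun j => c (S j) * RtoC t ^ S j)%C (RtoC 0)).
  { apply (is_series_incr_1 (V := C_NormedModule) (fun j => c j * RtoC t ^ j)%C).
    replace (plus _ _) with (RtoC 0); [now apply H|].
    rewrite (Z c H). change (RtoC 0 = 0 + 0 * 1)%C. ring. }
  replace (RtoC 0) with (/ RtoC t * 0)%C by ring.
  generalize (is_Cseries_scal (/ RtoC t)%C _ _ H'). apply is_Cseries_ext.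
  intro k. rewrite Cpow_S. field. assumption.
Qed.

(** Coefficients of [z (A / z + CPS d z)], the form in which [meromorphic_at] describes a pole of
    order at most 1. *)
Definition laurent_coef (A : C) (d : nat -> C) (j : nat) : C :=
  match j with O => A | S j => d j end.

Lemma is_pseries_laurent_coef (rho : R) (A : C) (d : nat -> C) (B : R) (z : C) :
  0 < rho -> normal rho d B -> Cmod z < rho ->
  @is_pseries C_AbsRing C_NormedModule (laurent_coef A d) z (A + z * CPS d z)%C.
Proof.
  intros H0 Hd Hz. apply is_pseries_Cseries.
  apply (is_series_decr_1 (V := C_NormedModule)).
  replace (plus _ _) with (z * CPS d z)%C.
  - generalize (is_Cseries_scal z _ _ (normal_CPS _ _ _ z H0 Hd Hz)).
    apply is_Cseries_ext. intro j. simpl. ring.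
  - change (z * CPS d z = A + z * CPS d z + - (A * 1))%C. ring.
Qed.

(** The order [N] given by [meromorphic_at] is arbitrary, so negative powers are cleared on both
    sides: [c1] expands [z * (z^N * F (a + z))] and [c2] expands [z^N * (A + z * CPS d z)]. They
    agree at positive reals, hence have equal coefficients, and the equality spreads to the
    punctured disc. *)
Lemma meromorphic_unique (F : C -> C) (a A : C) (d : nat -> C) (B rho : R) :
  0 < rho -> normal rho d B -> meromorphic_at F a ->
  (forall t : R, 0 < t < rho -> F (a + RtoC t)%C = (A / RtoC t + CPS d (RtoC t))%C) ->
  exists delta, 0 < delta <= rho /\ forall z : C, z <> 0 -> Cmod z < delta ->
    F (a + z)%C = (A / z + CPS d z)%C.
Proof.
  intros H0 Hd (N & c & rho' & Hrho' & Hc) HF.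
  assert (Haz : forall z : C, (a + z - a = z)%C) by (intro; ring).
  set (delta := Rmin rho rho').
  assert (Hdelta : 0 < delta) by now apply Rmin_glb_lt.
  assert (D1 : delta <= rho) by apply Rmin_l.
  assert (D2 : delta <= rho') by apply Rmin_r.
  set (c1 := PS_incr_1 (V := C_NormedModule) c : nat -> C).
  set (c2 := PS_incr_n (V := C_NormedModule) (laurent_coef A d) N : nat -> C).
  assert (Hpow : forall (z : C) n, @pow_n C_Ring z n = (z ^ n)%C).
  { reflexivity. }
  assert (H1 : forall z : C, z <> 0 -> Cmod z < delta ->
    is_Cseries (fun j => c1 j * z ^ j)%C (z * (z ^ N * F (a + z)))%C).
  { intros z Hz Hzd. apply is_pseries_Cseries.
    apply (is_pseries_incr_1 (V := C_NormedModule)).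
    rewrite <- (Haz z) at 1 2. apply Hc; rewrite ?Haz; [|lra].
    intro E. apply Hz. rewrite <- (Haz z), E. ring. }
  assert (H2 : forall z : C, z <> 0 -> Cmod z < delta ->
    is_Cseries (fun j => c2 j * z ^ j)%C (z ^ N * (A + z * CPS d z))%C).
  { intros z Hz Hzd. apply is_pseries_Cseries. rewrite <- Hpow.
    apply (is_pseries_incr_n (V := C_NormedModule)).
    apply (is_pseries_laurent_coef rho A d B); [assumption | assumption | lra]. }
  assert (E12 : forall j, c1 j = c2 j).
  { intro j.
    assert (Z := power_series_vanishing (fun j => c1 j - c2 j)%C delta Hdelta).
    cut ((c1 j - c2 j)%C = 0).
    { intro E. replace (c1 j) with ((c1 j - c2 j) + c2 j)%C by ring.
      rewrite E. ring. }
    apply Z. intros t Ht.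
    assert (Ht0 : RtoC t <> 0) by (intro E; apply RtoC_inj in E; lra).
    assert (Hm : Cmod (RtoC t) < delta) by (rewrite Cmod_R, Rabs_pos_eq; lra).
    generalize (is_Cseries_minus _ _ _ _ (H1 _ Ht0 Hm) (H2 _ Ht0 Hm)).
    rewrite HF by lra.
    match goal with |- is_Cseries _ ?l -> is_Cseries _ ?l' =>
      replace l with l' by (field; assumption) end.
    apply is_Cseries_ext. intro k. ring. }
  exists delta. split; [split; assumption|]. intros z Hz Hzd.
  assert (E : (z * (z ^ N * F (a + z)))%C = (z ^ N * (A + z * CPS d z))%C).
  { rewrite <- (is_Cseries_unique _ _ (H1 z Hz Hzd)).
    apply is_Cseries_unique. generalize (H2 z Hz Hzd). apply is_Cseries_ext.
    intro j. now rewrite E12. }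
  assert (HzN : (z ^ N)%C <> 0) by now apply Cpow_nz.
  replace (F (a + z)%C) with (/ z * / z ^ N * (z * (z ^ N * F (a + z))))%C
    by (field; split; assumption).
  rewrite E. field. split; assumption.
Qed.

(** * From real constants to [zeta], and the error term *)

Lemma RtoC_sum_n_m (u : nat -> R) (n m : nat) :
  RtoC (sum_n_m u n m) = sum_n_m (fun k => RtoC (u k)) n m.
Proof.
  destruct (Nat.le_gt_cases n m) as [H|H].
  - induction H as [|m H IH]; [now rewrite !sum_n_n|].
    rewrite !sum_n_Sm by lia. rewrite <- IH. apply RtoC_plus.
  - now rewrite !sum_n_m_zero.
Qed.

Lemma cross_constant_zeta (x : R) (p : nat) : 0 < x ->
  RtoC (cross_constant x p) =
  (RtoC x ^ S p *
    sum_n_m (fun k : nat =>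
      Binomial.C (S p) k * (1 / RtoC x ^ k)
      * zeta (INR (S (S p) - k)) * zeta (INR (k + 1)))%C 1 p)%C.
Proof.
  intro Hx.
  rewrite (sum_n_m_ext_loc _ (fun k => RtoC (Binomial.C (S p) k * (/ x ^ k)
    * zetaR (S (S p) - k) * zetaR (k + 1)))).
  - rewrite <- RtoC_sum_n_m, <- RtoC_pow, <- RtoC_mult. f_equal.
    unfold cross_constant.
    transitivity (mult (x ^ S p) (sum_n_m (fun k => Binomial.C (S p) k * (/ x ^ k)
    * zetaR (S (S p) - k) * zetaR (k + 1)) 1 p)); [|reflexivity].
    rewrite <- (sum_n_m_mult_l (K := R_Ring)).
    apply sum_n_m_ext_loc. intros k Hk.
    change (Binomial.C (S p) k * x ^ (S p - k) * (zetaR (S (S p) - k) * zetaR (k + 1))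
      = x ^ S p * (Binomial.C (S p) k * / x ^ k * zetaR (S (S p) - k) * zetaR (k + 1))).
    replace (x ^ S p) with (x ^ (S p - k) * x ^ k) by (rewrite <- pow_add; f_equal; lia).
    field. apply pow_nonzero. lra.
  - intros k Hk. rewrite !zeta_INR by lia.
    rewrite <- RtoC_pow, !RtoC_mult, RtoC_inv by (apply pow_nonzero; lra).
    unfold Cdiv. rewrite Cmult_1_l. reflexivity.
Qed.

Theorem theorem1p1 (x : R) (r : nat) (hx : 0 < x) (hr : (2 <= r)%nat) :
  (exists F : C -> C, is_Theta_continuation x r F) /\
  forall F : C -> C, is_Theta_continuation x r F ->
  exists M : R,
    locally' (RtoC (1 - INR r)) (fun t : C =>
      Cmod (F t -
        (zeta (INR r) * (1 + x ^ (r - 1)) / (t - (1 - INR r))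
         + x ^ (r - 1) * zeta (INR r) * (euler_gamma - ln x)
         + euler_gamma * zeta (INR r)
         + x ^ (r - 1) *
           sum_n_m (fun k : nat =>
             Binomial.C (r - 1) k * (1 / x ^ k)
             * zeta (INR (r - k)) * zeta (INR (k + 1))) 1 (r - 2)))%C
      <= M * Cmod (t - (1 - INR r))%C).
Proof.
  destruct r as [|[|p]]; [lia | lia | clear hr].
  replace (S (S p) - 1)%nat with (S p) by lia.
  replace (S (S p) - 2)%nat with p by lia.
  rewrite <- cross_constant_zeta by assumption.
  rewrite zeta_INR, <- RtoC_minus by lia.
  set (r := S (S p)). set (a := 1 - INR r).
  destruct (Theta_expansion x p hx) as (d & B & Hd & d0 & HTheta).
  fold r a in HTheta, d0.
  set (A := RtoC (zetaR r * (1 + x ^ S p))) in HTheta.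
  assert (H4 : 0 < 1/4) by lra.
  split.
  (* The series to the right of [Re t = a] is glued to the Laurent expansion elsewhere; in the right
     half of the disc the two agree by [Theta_expansion]. *)
  - exists (fun t => if Rlt_dec a (Re t) then Theta_series (INR r) (INR r) t x
      else (A / (t - a) + CPS d (t - a))%C).
    split.
    + intros t Ht. destruct (Rlt_dec a (Re t)); [reflexivity | contradiction].
    + exists 1%nat, (laurent_coef A d), (1/4). split; [assumption|].
      intros t. fold a. intros Hta Ht.
      assert (Hz : (t - a)%C <> 0).
      { intro E. apply Hta. replace t with ((t - a) + a)%C by ring.
        rewrite E. apply Cplus_0_l. }
      assert (Hre : Re (t - a)%C = Re t - a) by reflexivity.
      replace (if Rlt_dec _ _ then _ else _) with (A / (t - a) + CPS d (t - a))%C.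
      * replace ((t - a) ^ 1 * (A / (t - a) + CPS d (t - a)))%C
          with (A + (t - a) * CPS d (t - a))%C by (field; assumption).
        now apply (is_pseries_laurent_coef (1/4) A d B).
      * destruct (Rlt_dec a (Re t)) as [H|H]; [|reflexivity].
        rewrite <- HTheta by (rewrite ?Hre; lra). f_equal. ring.
  - intros F [HF Hmer].
    destruct (meromorphic_unique F a A d B (1/4)) as (delta & [D1 D2] & HFa);
      try assumption.
    { intros t Ht. rewrite HF.
      - apply HTheta; [simpl; lra|]. rewrite Cmod_R, Rabs_pos_eq; lra.
      - change (a < a + t). lra. }
    (* From [normal_tail] at radius 1/4 with [J = 0]: the sum up to degree 0 is [d 0], the constant
       of the theorem, and the tail is at most [B * (Cmod z / (1/4))]. *)
    exists (B * 4).
    assert (Hb : locally (RtoC a) (fun t : C => Cmod (t - a)%C < delta)).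
    { assert (He : 0 < delta / 2) by lra.
      exists (mkposreal _ He). intros t Ht.
      apply C_NormedModule_mixin_compat2 in Ht.
      change (Cmod (t - a)%C < sqrt 2 * (delta / 2)) in Ht.
      assert (sqrt 2 < 2) by (generalize (sqrt_lt_1 2 4 ltac:(lra) ltac:(lra) ltac:(lra));
        replace 4 with (2 ^ 2) by ring; rewrite sqrt_pow2; lra).
      nra. }
    unfold locally', within. revert Hb. apply filter_imp.
    refine (fun (t : C) Ht Hta => _).
    set (z := (t - a)%C) in *.
    assert (Hz : z <> 0).
    { intro E. apply Hta. replace t with (z + a)%C by (unfold z; ring).
      rewrite E. apply Cplus_0_l. }
    assert (Et : t = (a + z)%C) by (unfold z; ring).
    rewrite Et, HFa by assumption.
    assert (HT := normal_tail (1/4) d B z O H4 Hd ltac:(lra)).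
    rewrite sum_O in HT. simpl (z ^ 0)%C in HT. rewrite Cmult_1_r, d0 in HT.
    replace (B * (Cmod z / (1/4)) ^ 1) with (B * 4 * Cmod z) in HT by (simpl; field).
    eapply Rle_trans; [|exact HT]. apply Req_le. f_equal.
    unfold A. rewrite <- !RtoC_pow, !RtoC_plus, !RtoC_mult, !RtoC_plus, !RtoC_minus.
    field. assumption.
Qed.
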